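(* Consider the model, the prior and the asymptotic setting described in the context, and assume: (1) (Lipschitz) $|f(x,t)-f(y,t)|\le K\|x-y\|_2$ for all $x,y\in\mathbb{R}^q$, $t\in\mathbb{R}$, for a fixed constant $K>0$. (2) (True regression vector) $\mathcal{B}_0=\{\beta_0\in\mathbb{R}^{qp}\setminus\{0\}:\ \|\beta_0\|_\infty\le c_0\lambda^{-1}\log p,\ s_0\log p\le \kappa_n n\}$, where $s_0=s_{\beta_0}$, $c_0>0$ is a fixed constant and $(\kappa_n)$ is a fixed sequence with $\kappa_n\to0$. (3) (True covariance) $\mathcal{H}_0=\{\Gamma\in\mathcal{H}:\ \underline{\rho_{\Gamma_0}}\le\rho_{\min}(\Gamma)\le\rho_{\max}(\Gamma)\le\overline{\rho_{\Gamma_0}}\}$ for fixed constants $0<\underline{\rho_{\Gamma_0}}\le\overline{\rho_{\Gamma_0}}<\infty$. (4) (Prior on the dimension) There are constants $A_1,A_2,A_3,A_4>0$ with $A_1p^{-A_3}\pi_p(s-1)\le\pi_p(s)\le A_2p^{-A_4}\pi_p(s-1)$ for $s=1,\dots,qp$. (5) (Laplace parameter) There are constants $L_1,L_2,L_3>0$ with $\dfrac{\|X\|_*K'}{L_1p^{L_2}}\le\lambda\le\dfrac{L_3\|X\|_*K'}{\sqrt n}$, where $K'=\sqrt{K^2M_{\mathrm{obs}}}$. (6) $\sum_{i=1}^n\mathbf{1}_{m_i\ge r}\asymp n$. (7) There is a constant $\underline{\rho_Z}>0$ with $\min_i\{\rho_{\min}^{1/2}(Z_i^\top Z_i): m_i\ge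 r\}\ge\underline{\rho_Z}$. (8) There is a constant $\overline{\rho_Z}>0$ with $\max_i\|Z_i\|_{sp}\le\overline{\rho_Z}$. Then there exists a constant $C_1>0$ such that $$\sup_{\beta_0\in\mathcal{B}_0,\ \Gamma_0\in\mathcal{H}_0}\mathbb{E}_0\Big[\Pi\big(\beta:\ |S_\beta|>C_1s_0\ \big|\ Y^{(n)}\big)\Big]\underset{n\to\infty}{\longrightarrow}0 .$$
   Context: Notation. For a vector $\theta$, $S_\theta=\{j:\theta_j\ne0\}$ and $s_\theta=|S_\theta|$; $\|\cdot\|_1,\|\cdot\|_2,\|\cdot\|_\infty$ are the usual norms. For a matrix $A$: $\rho_{\min}(A),\rho_{\max}(A)$ are the smallest and largest eigenvalues (square case), $\|A\|_{sp}=\rho_{\max}^{1/2}(A^\top A)$, and $\|A\|_*=\max_j\|A_{\cdot j}\|_2$, the maximum Euclidean norm of a column. $a_n\lesssim b_n$ means $a_n\le Cb_n$ for all $n$ large enough, with $C>0$ independent of $n$; $a_n\asymp b_n$ means $a_n\lesssim b_n\lesssim a_n$. All quantities called constants or fixed do not depend on $n$. Asymptotic setting. $n\to\infty$ is the number of subjects; $q,r\ge1$ (integers), $\sigma^2>0$ and $f:\mathbb{R}^q\times\mathbb{R}\to\mathbb{R}$ are fixed and known; $p=p_n>n$; $m_i\ge1$ are integers with $\max_{1\le i\le n}m_i\le M_{\mathrm{obs}}$ for a fixed constant $M_{\mathrm{obs}}$. The times $t_{ij}\in\mathbb{R}$ ($1\le j\le m_i$), the covariates $V_i\in\mathbb{R}^p$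 and the matrices $Z_i\in\mathbb{R}^{m_i\times r}$ are deterministic and known. $X_i\in\mathbb{R}^{q\times qp}$ is the block-diagonal matrix with $q$ diagonal blocks all equal to $V_i^\top$, and $X\in\mathbb{R}^{nq\times qp}$ is the matrix obtained by stacking $X_1,\dots,X_n$. $f_i(\varphi)=(f(\varphi,t_{i1}),\dots,f(\varphi,t_{im_i}))^\top$ for $\varphi\in\mathbb{R}^q$. Model. $Y_i=f_i(X_i\beta)+Z_i\xi_i+\varepsilon_i$, $i=1,\dots,n$, with $\xi_i$ i.i.d. $\mathcal{N}_r(0,\Gamma)$ and $\varepsilon_i$ independent $\mathcal{N}_{m_i}(0,\sigma^2I_{m_i})$, all independent. So the $Y_i$ are independent with $Y_i\sim\mathcal{N}_{m_i}(f_i(X_i\beta),\Delta_{\Gamma,i})$, $\Delta_{\Gamma,i}=Z_i\Gamma Z_i^\top+\sigma^2I_{m_i}$. The parameters are $\beta\in\mathcal{B}=\mathbb{R}^{qp}$ and $\Gamma\in\mathcal{H}$, the set of real symmetric positive-definite $r\times r$ matrices. $Y^{(n)}=(Y_i)_{1\le i\le n}$; $p_{\beta,\Gamma}=\prod_{i=1}^np_{\beta,\Gamma,i}$ is its density. The data are generated under true parameters $(\beta_0,\Gamma_0)$; $\mathbb{E}_0$ is the corresponding expectation, $p_0=p_{\beta_0,\Gamma_0}$, $s_0=s_{\beta_0}$. Prior. $\beta$ and $\Gamma$ are independent under the prior $\Pi$. For $\beta$: a size $s\in\{0,\dots,qp\}$ is drawn from a probability mass function $\pi_p$; given $s$, a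 support $S\subset\{1,\dots,qp\}$ with $|S|=s$ is drawn uniformly; given $S$, the coordinates $\beta_\ell$, $\ell\in S$, are independent Laplace with density $\frac{\lambda}{2}e^{-\lambda|x|}$, and $\beta_\ell=0$ for $\ell\notin S$; $\lambda=\lambda_n>0$. $\Gamma$ has an inverse-Wishart prior with density proportional to $|\Gamma|^{-(d+r+1)/2}\exp(-\frac12\mathrm{Tr}(\Sigma\Gamma^{-1}))$, with $\Sigma$ a fixed positive-definite $r\times r$ matrix and $d>r-1$ fixed. Posterior. $\Pi(B\mid Y^{(n)})=\dfrac{\int_B\Lambda_n(\beta,\Gamma)\,d\Pi(\beta,\Gamma)}{\int\Lambda_n(\beta,\Gamma)\,d\Pi(\beta,\Gamma)}$ for measurable $B\subset\mathcal{B}\times\mathcal{H}$, where $\Lambda_n(\beta,\Gamma)=\prod_{i=1}^np_{\beta,\Gamma,i}(Y_i)/p_{\beta_0,\Gamma_0,i}(Y_i)$; the posterior of a set of values of $\beta$ alone is its marginal. *)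

(* Defs.v *)
(* Indices are 0-based: subject i : 'I_n stands
   for subject i + 1, and likewise for the times, coordinates and matrix
   entries. *)
From HB Require Import structures.
From mathcomp Require Export all_boot all_order all_algebra.
From mathcomp Require Export all_classical all_reals all_analysis.

Set Implicit Arguments.
Unset Strict Implicit.
Unset Printing Implicit Defensive.

Import Order.TTheory GRing.Theory Num.Theory numFieldNormedType.Exports.

Local Open Scope classical_set_scope.
Local Open Scope ring_scope.

Section asymptotics.
Context {R : realType}.
Implicit Types a b : nat -> R.

Definition asymp_le a b : Prop :=
  exists C, 0 < C /\ \forall n \near \oo, a n <= C * b n.

Definition asymp_eq a b : Prop := asymp_le a b /\ asymp_le b a.

(* Supremum in [0, +oo] of a set of nonnegative values; unlike [ereal_sup],
   the supremum of the empty set is 0 and not -oo. *)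
Definition esup0 (A : set (\bar R)) : \bar R := ereal_sup ([set 0%E] `|` A).

End asymptotics.

Section vectors_matrices.
Context {R : realType}.

Definition supp n (v : 'cV[R]_n) : {set 'I_n} := [set j | v j 0 != 0].

Definition norm2 n (v : 'cV[R]_n) : R := Num.sqrt (\sum_j v j 0 ^+ 2).

Definition norm_inf n (v : 'cV[R]_n) : R := \big[Num.max/0]_j `|v j 0|.

Definition norm_col m n (A : 'M[R]_(m, n)) : R :=
  \big[Num.max/0]_j norm2 (col j A).

(* Only applied to symmetric real matrices of positive size, whose set of
   eigenvalues is finite and nonempty. *)
Definition rho_min n (A : 'M[R]_n) : R := inf [set a | eigenvalue A a].
Definition rho_max n (A : 'M[R]_n) : R := sup [set a | eigenvalue A a].

Definition norm_sp m n (A : 'M[R]_(m, n)) : R :=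
  Num.sqrt (rho_max (A^T *m A)).

Definition posdefmx n (A : 'M[R]_n) : Prop :=
  A^T = A /\ forall v : 'cV[R]_n, v != 0 -> 0 < (v^T *m A *m v) 0 0.

End vectors_matrices.

Section lebesgue_tuple.
Context {R : realType}.

Definition tcons n (z : R * n.-tuple R) : n.+1.-tuple R :=
  [tuple of z.1 :: z.2].

Lemma measurable_tcons n : measurable_fun [set: R * n.-tuple R] (@tcons n).
Proof. exact: measurable_cons. Qed.

Section cons.
Variables (n : nat) (mu : {measure set (n.-tuple R) -> \bar R}).

Definition lebesgue_cons : set (n.+1.-tuple R) -> \bar R :=
  pushforward (lebesgue_measure \x^ mu)%E (@tcons n).

Let lebesgue_cons0 : lebesgue_cons set0 = 0%E.
Proof. by rewrite /lebesgue_cons /pushforward preimage_set0 measure0. Qed.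

Let lebesgue_cons_ge0 A : (0 <= lebesgue_cons A)%E.
Proof. exact: (measure_ge0 (lebesgue_measure \x^ mu)%E). Qed.

Let lebesgue_cons_sigma_additive : semi_sigma_additive lebesgue_cons.
Proof.
apply: measure_semi_sigma_additive; exact: measurable_tcons.
Qed.

HB.instance Definition _ := isMeasure.Build _ _ _ lebesgue_cons
  lebesgue_cons0 lebesgue_cons_ge0 lebesgue_cons_sigma_additive.

End cons.

(* Lebesgue measure on R^n. *)
Fixpoint lebesgue_tuple n : {measure set (n.-tuple R) -> \bar R} :=
  match n with
  | 0 => \d_([tuple] : 0.-tuple R)
  | n'.+1 => lebesgue_cons (lebesgue_tuple n')
  end.

End lebesgue_tuple.

(* The deterministic and known part of the experiment with n subjects:
   m_i, (t_ij)_j, V_i and Z_i. *)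
Record design (R : realType) (p r n : nat) := Design {
  nobs : 'I_n -> nat ;
  time : forall i, 'I_(nobs i) -> R ;
  covariate : 'I_n -> 'cV[R]_p ;
  random_design : forall i, 'M[R]_(nobs i, r) }.

Section model.
Context {R : realType} {q p r n : nat}.
Variables (f : 'cV[R]_q -> R -> R) (sigma2 : R) (D : design R p r n).

(* X_i : the q x p matrix with V_i^T as row k and 0 elsewhere, read row by row,
   is row k of the block-diagonal matrix with q diagonal blocks V_i^T. *)
Definition Xi (i : 'I_n) : 'M[R]_(q, q * p) :=
  \matrix_(k < q) mxvec (delta_mx k 0 *m (covariate D i)^T).

Definition Xmx : 'M[R]_(\sum_(i < n) q, q * p) := \mxcol_(i < n) Xi i.

Definition reg_mean (beta : 'cV[R]_(q * p)) (i : 'I_n) : 'cV[R]_(nobs D i) :=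
  \col_j f (Xi i *m beta) (time (d := D) j).

Definition Delta (Gamma : 'M[R]_r) (i : 'I_n) : 'M[R]_(nobs D i) :=
  random_design D i *m Gamma *m (random_design D i)^T + sigma2%:M.

Definition gauss_pdf m (mu : 'cV[R]_m) (V : 'M[R]_m) (y : 'cV[R]_m) : R :=
  (Num.sqrt ((2 * pi) ^+ m * \det V))^-1 *
  expR (- ((y - mu)^T *m invmx V *m (y - mu)) 0 0 / 2).

(* Y^(n) = (Y_1, ..., Y_n), as a point of R^(m_1 + ... + m_n). *)
Definition sample := (\sum_(i < n) nobs D i).-tuple R.

Definition obs (y : sample) (i : 'I_n) : 'cV[R]_(nobs D i) :=
  submxcol (\col_k tnth y k) i.

Definition pdf_i beta Gamma (y : sample) (i : 'I_n) : R :=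
  gauss_pdf (reg_mean beta i) (Delta Gamma i) (obs y i).

Definition pdf beta Gamma (y : sample) : R := \prod_(i < n) pdf_i beta Gamma y i.

Definition expectation beta Gamma (g : sample -> \bar R) : \bar R :=
  (\int[lebesgue_tuple _]_y ((pdf beta Gamma y)%:E * g y))%E.

Definition lik_ratio beta0 Gamma0 beta Gamma (y : sample) : R :=
  \prod_(i < n) (pdf_i beta Gamma y i / pdf_i beta0 Gamma0 y i).

End model.

(* The marginal priors are given by the integral operators
   h |-> \int h(beta) dPi(beta) and h |-> \int h(Gamma) dPi(Gamma). *)
Section prior.
Context {R : realType}.

(* The vector supported in S whose coordinates in S, listed increasingly,
   are x. *)
Definition embed N (S : {set 'I_N}) (x : #|S|.-tuple R) : 'cV[R]_N :=
  \col_l if l \in S then nth 0 x (index l (enum S)) else 0.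

Definition laplace_pdf (lambda x : R) : R := lambda / 2 * expR (- (lambda * `|x|)).

Definition prior_beta_int N (pmf : nat -> R) (lambda : R)
    (h : 'cV[R]_N -> \bar R) : \bar R :=
  (\sum_(S : {set 'I_N}) (pmf #|S| / 'C(N, #|S|)%:R)%R%:E *
    \int[lebesgue_tuple #|S|]_x
      ((\prod_(k < #|S|) laplace_pdf lambda (tnth x k))%R%:E * h (embed x)))%E.

(* Lebesgue measure on symmetric matrices is Lebesgue measure in the
   r(r + 1)/2 = 'C(r + 1, 2) coordinates Gamma_ij, i <= j; the coordinate (i, j)
   is stored at position j(j + 1)/2 + i = 'C(j + 1, 2) + i. *)
Definition symmx r (g : 'C(r.+1, 2).-tuple R) : 'M[R]_r :=
  \matrix_(i, j) nth 0 g ('C((maxn i j).+1, 2) + minn i j).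

Definition posdef_cone r : set ('C(r.+1, 2).-tuple R) :=
  [set g | posdefmx (symmx g)].
Arguments posdef_cone : clear implicits.

Definition iwishart_kernel r (d : R) (Sigma G : 'M[R]_r) : R :=
  (\det G) `^ (- ((d + r%:R + 1) / 2)) * expR (- (\tr (Sigma *m invmx G) / 2)).

Definition iwishart_mass r (d : R) (Sigma : 'M[R]_r) : R :=
  fine (\int[lebesgue_tuple _]_(g in posdef_cone r)
    (iwishart_kernel d Sigma (symmx g))%:E)%E.

Definition prior_Gamma_int r (d : R) (Sigma : 'M[R]_r)
    (h : 'M[R]_r -> \bar R) : \bar R :=
  (\int[lebesgue_tuple _]_(g in posdef_cone r)
    ((iwishart_kernel d Sigma (symmx g) / iwishart_mass d Sigma)%R%:E *
     h (symmx g)))%E.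

Definition prior_int N r (pmf : nat -> R) (lambda d : R) (Sigma : 'M[R]_r)
    (h : 'cV[R]_N * 'M[R]_r -> \bar R) : \bar R :=
  prior_beta_int pmf lambda (fun beta =>
    prior_Gamma_int d Sigma (fun Gamma => h (beta, Gamma))).

End prior.

Definition posterior (R : realType) (q p r n : nat) (f : 'cV[R]_q -> R -> R)
    (sigma2 : R) (D : design R p r n)
    (pmf : nat -> R) (lambda d : R) (Sigma : 'M[R]_r)
    (beta0 : 'cV[R]_(q * p)) (Gamma0 : 'M[R]_r) (y : sample D)
    (B : set ('cV[R]_(q * p) * 'M[R]_r)) : \bar R :=
  let L z := lik_ratio f sigma2 beta0 Gamma0 z.1 z.2 y in
  (prior_int pmf lambda d Sigma (fun z => (\1_B z * L z)%R%:E) /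
   prior_int pmf lambda d Sigma (fun z => (L z)%:E))%E.

Definition true_betas (R : realType) (q p n : nat) (c0 lambda kappa : R) :
    set 'cV[R]_(q * p) :=
  [set b | [/\ b != 0, norm_inf b <= c0 * lambda^-1 * ln p%:R &
    #|supp b|%:R * ln p%:R <= kappa * n%:R]].

Definition true_Gammas (R : realType) (r : nat) (lo hi : R) : set 'M[R]_r :=
  [set G | posdefmx G /\ [/\ lo <= rho_min G, rho_min G <= rho_max G &
    rho_max G <= hi]].

(* Main.v *)
(* Write the posterior mass of {|S_beta| > C1 s0} as num / den. On the event
   {Q0 <= n^2}, where Q0 is the quadratic form of the true Gaussian density, the
   likelihood ratio is bounded below by a constant on a box of polynomially small
   radius around (beta0, Gamma0), inside the model supported by S_{beta0}: the box for
   Gamma contains only matrices dominating Gamma0, so the precision matrices only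
   decrease, while the mean changes by O(p^-2). Hence there den >= p^(-c s0) pi_p(s0)
   deterministically, with no Kullback-Leibler computation. The event fails with
   probability at most 2^(sum m_i / 2) exp(-n^2 / 4) by a Chernoff bound. Finally
   E_0[num] is at most the prior mass of {|S| > C1 s0}, which is at most
   p^(-c' s0) pi_p(s0) with c' as large as desired, by Tonelli and because Gaussian
   densities integrate to 1. *)
Require Import Defs.
From HB Require Import structures.
From mathcomp Require Import ring lra zify measurable_realfun.

Set Implicit Arguments.
Unset Strict Implicit.
Unset Printing Implicit Defensive.

Import Order.TTheory GRing.Theory Num.Theory numFieldNormedType.Exports.

Local Open Scope classical_set_scope.
Local Open Scope ring_scope.

(** * Quadratic forms and Schur complements *)

Section quadratic_forms.
Context {R : realType}.

(** The obstacle is a lower bound on the evidence that holds at every data point of a likely event,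
    uniformly over the truth. Neighbourhoods of radius polynomial in 1/p are affordable: as
    [s0 >= 1], they cost a factor p^-O(s0), and the decay of the prior on the dimension beats any
    such power once [C1] is large.

    Such radii allow the crude threshold n^2. Q0 is typically of order sum m_i <= Mobs n, so
    exceeding n^2 is exponentially rare. In Young's inequality with weight n^-2, Q0 then contributes
    at most 1, and the mean shift a multiple of n^3 p^-4.

    Domination of Gamma0 matters for the same reason. The radius for Gamma is 1/p, and a two-sided
    perturbation of that size could raise the quadratic form by the order of n^2 / p, which is
    unbounded when p is close to n. With domination only the determinants lose something, a factor
    exp(-O(sum m_i / p)), bounded below. *)

Definition qf n (A : 'M[R]_n) (v : 'cV[R]_n) : R := (v^T *m A *m v) 0 0.
Definition sqn n (v : 'cV[R]_n) : R := \sum_k v k 0 ^+ 2.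

Lemma sqn_ge0 n (v : 'cV[R]_n) : 0 <= sqn v.
Proof. by apply: sumr_ge0 => k _; exact: sqr_ge0. Qed.

Lemma sqnE n (v : 'cV[R]_n) : sqn v = (v^T *m v) 0 0.
Proof. by rewrite mxE; apply: eq_bigr => k _; rewrite mxE expr2. Qed.

Lemma sqn_eq0 n (v : 'cV[R]_n) : (sqn v == 0) = (v == 0).
Proof.
rewrite psumr_eq0; last by move=> k _; exact: sqr_ge0.
apply/allP/eqP => [v0|-> k _]; last by rewrite mxE expr0n eqxx.
apply/colP => k; have := v0 k (mem_index_enum _).
by rewrite mxE sqrf_eq0 => /eqP.
Qed.

Lemma sqn_gt0 n (v : 'cV[R]_n) : v != 0 -> 0 < sqn v.
Proof. by move=> v0; rewrite lt_neqAle eq_sym sqn_eq0 v0 sqn_ge0. Qed.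

Lemma qfE n (A : 'M[R]_n) v : qf A v = \sum_i \sum_j v i 0 * A i j * v j 0.
Proof.
rewrite /qf mxE exchange_big; apply: eq_bigr => j _.
by rewrite mxE mulr_suml; apply: eq_bigr => i _; rewrite mxE.
Qed.

Lemma qf_tr n (A : 'M[R]_n) (u v : 'cV_n) : A^T = A ->
  (u^T *m A *m v) 0 0 = (v^T *m A *m u) 0 0.
Proof.
move=> At; have -> : v^T *m A *m u = (u^T *m A *m v)^T.
  by rewrite !trmx_mul trmxK At mulmxA.
by rewrite [RHS]mxE.
Qed.

Lemma addmxE m n (A B : 'M[R]_(m, n)) i j : (A + B) i j = A i j + B i j.
Proof. by rewrite mxE. Qed.

Lemma qfD n (A : 'M[R]_n) u v : A^T = A ->
  qf A (u + v) = qf A u + 2 * (u^T *m A *m v) 0 0 + qf A v.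
Proof.
move=> At; rewrite /qf (linearD trmx) !mulmxDl !mulmxDr.
rewrite (addmxE _ (_ + _)) !addmxE (qf_tr v u At); ring.
Qed.

Lemma qfZ n (A : 'M[R]_n) c (v : 'cV_n) : qf A (c *: v) = c ^+ 2 * qf A v.
Proof. by rewrite /qf [(_ *: v)^T]linearZ /= -!scalemxAl -scalemxAr scalerA mxE expr2. Qed.

Lemma qfN n (A : 'M[R]_n) v : qf A (- v) = qf A v.
Proof. by rewrite -scaleN1r qfZ sqrrN expr1n mul1r. Qed.

Lemma qf_addmx n (A B : 'M[R]_n) v : qf (A + B) v = qf A v + qf B v.
Proof. by rewrite /qf mulmxDr mulmxDl mxE. Qed.

Lemma qf_scalemx n c (A : 'M[R]_n) v : qf (c *: A) v = c * qf A v.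
Proof. by rewrite /qf -scalemxAr -scalemxAl mxE. Qed.

Lemma qf_scalar n c (v : 'cV[R]_n) : qf c%:M v = c * sqn v.
Proof. by rewrite /qf mul_mx_scalar -scalemxAl mxE sqnE. Qed.

Lemma qf_congr m n (Z : 'M[R]_(m, n)) A v : qf (Z *m A *m Z^T) v = qf A (Z^T *m v).
Proof. by rewrite /qf trmx_mul trmxK !mulmxA. Qed.

Lemma posdef_qf_ge0 n (A : 'M[R]_n) v : posdefmx A -> 0 <= qf A v.
Proof.
move=> [_ A0]; have [->|v0] := eqVneq v 0; last exact/ltW/A0.
by rewrite /qf mulmx0 mxE.
Qed.

Lemma posdef_scalar n (c : R) : 0 < c -> posdefmx (c%:M : 'M[R]_n).
Proof.
move=> c0; split; first by rewrite tr_scalar_mx.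
by move=> v v0; rewrite -/(qf _ _) qf_scalar mulr_gt0// sqn_gt0.
Qed.

Lemma posdef_ge n (A B : 'M[R]_n) : posdefmx A -> B^T = B ->
  (forall v, qf A v <= qf B v) -> posdefmx B.
Proof.
by move=> [_ A0] Bt AB; split=> // v v0; exact: lt_le_trans (A0 _ v0) (AB v).
Qed.

Lemma posdef_unitmx n (A : 'M[R]_n) : posdefmx A -> A \in unitmx.
Proof.
move=> [At A0]; rewrite -row_free_unit -kermx_eq0.
apply/eqP/row_matrixP => i; rewrite row0; apply/eqP/negPn/negP => ui0.
set u := row i (kermx A) in ui0; have uA : u *m A = 0.
  by rewrite /u -row_mul mulmx_ker row0.
have ut0 : u^T != 0 by apply: contra ui0 => /eqP /(congr1 trmx); rewrite trmxK trmx0 => ->.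
by have := A0 _ ut0; rewrite trmxK uA mul0mx mxE ltxx.
Qed.

Lemma qf_invmx n (A : 'M[R]_n) v : posdefmx A ->
  qf (invmx A) v = qf A (invmx A *m v).
Proof.
move=> pA; rewrite /qf trmx_mul trmx_inv pA.1 -!mulmxA.
by rewrite [A *m _]mulmxA mulmxV ?posdef_unitmx// mul1mx.
Qed.

Lemma posdef_invmx n (A : 'M[R]_n) : posdefmx A -> posdefmx (invmx A).
Proof.
move=> pA; split; first by rewrite trmx_inv pA.1.
move=> v v0; rewrite -/(qf _ _) qf_invmx//; apply: pA.2.
by apply: contra v0 => /eqP /(congr1 (mulmx A)); rewrite mulKVmx ?posdef_unitmx// mulmx0 => ->.
Qed.

(* [v^T A^-1 v = sup_w (2 v^T w - w^T A w)], evaluated at [w = B^-1 v] *)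
Lemma qf_invmx_le n (A B : 'M[R]_n) v : posdefmx A -> posdefmx B ->
  (forall w, qf A w <= qf B w) -> qf (invmx B) v <= qf (invmx A) v.
Proof.
move=> pA pB AB; set w := invmx B *m v.
have := posdef_qf_ge0 (w - invmx A *m v) pA.
rewrite qfD ?pA.1// qfN -qf_invmx// mulmxN mxE -!mulmxA.
rewrite [A *m _]mulmxA mulmxV ?posdef_unitmx// mul1mx.
have -> : (w^T *m v) 0 0 = qf (invmx B) v.
  by rewrite /w trmx_mul trmx_inv pB.1.
have := AB w; rewrite -qf_invmx//; lra.
Qed.

(** Nonnegativity of the form at [t *: u - v], divided by [t], bounds the cross term. *)
Lemma qf_young n (A : 'M[R]_n) u v t : posdefmx A -> 0 < t ->
  qf A (u + v) <= (1 + t) * qf A u + (1 + t^-1) * qf A v.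
Proof.
move=> pA t0; rewrite qfD ?pA.1//.
have := posdef_qf_ge0 (t *: u - v) pA.
rewrite qfD ?pA.1// qfN qfZ linearZ /= mulmxN -!scalemxAl !mxE.
set a := qf A u; set b := qf A v; set c := \sum_j _ => h.
have : 0 <= (t ^+ 2 * a + 2 * - (t * c) + b) / t by rewrite divr_ge0// ltW.
have -> : (t ^+ 2 * a + 2 * - (t * c) + b) / t = t * a - 2 * c + t^-1 * b.
  by field; rewrite gt_eqF.
lra.
Qed.

Section schur.
Variable n : nat.
Implicit Types A : 'M[R]_(1 + n).

(** Elimination of the first coordinate. It carries the inductions on the dimension for the sign of
    the determinant, the measurability of the positive definite cone and the Gaussian integral. *)
Definition schur A : 'M[R]_n :=
  drsubmx A - (A 0 0)^-1 *: (dlsubmx A *m ursubmx A).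

Lemma ulsubmx00 A : ulsubmx A = (A 0 0)%:M.
Proof.
rewrite [LHS]mx11_scalar; congr (_ %:M); rewrite !mxE.
by congr (A _ _); apply/val_inj.
Qed.

(** A block row operation, the matrix [E] of determinant 1, clears the column below the pivot. *)
Lemma det_schur A : A 0 0 != 0 -> \det A = A 0 0 * \det (schur A).
Proof.
move=> a0; pose E : 'M[R]_(1 + n) := block_mx 1%:M 0 (- (A 0 0)^-1 *: dlsubmx A) 1%:M.
have dE : \det E = 1 by rewrite det_lblock !det1 mulr1.
rewrite -[LHS]mul1r -dE -det_mulmx -[in E *m A](submxK A) mulmx_block.
rewrite ulsubmx00 !mul1mx !mul0mx !addr0 !mul_mx_scalar scalerA mulrN divff//.
rewrite scaleN1r addNr (_ : _ + drsubmx A = schur A); last first.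
  by rewrite /schur addrC -scalemxAl scaleNr.
by rewrite det_ublock det_scalar1.
Qed.

(** Completion of the square in the first coordinate. *)
Lemma qf_schur A (x : R) (y : 'cV[R]_n) : A^T = A -> A 0 0 != 0 ->
  qf A (col_mx x%:M y) =
  A 0 0 * (x + (A 0 0)^-1 * (ursubmx A *m y) 0 0) ^+ 2 + qf (schur A) y.
Proof.
move=> At a0; set c := (ursubmx A *m y) 0 0.
have dlE : dlsubmx A = (ursubmx A)^T by rewrite trmx_ursub At.
have cE : ursubmx A *m y = c%:M by rewrite [LHS]mx11_scalar.
have cE' : y^T *m dlsubmx A = c%:M by rewrite dlE -trmx_mul cE tr_scalar_mx.
have -> : qf (schur A) y = qf (drsubmx A) y - (A 0 0)^-1 * c ^+ 2.
  rewrite /schur -scaleNr qf_addmx qf_scalemx mulNr; congr (_ - _ * _).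
  by rewrite /qf mulmxA cE' -mulmxA cE -scalar_mxM mxE eqxx mulr1n expr2.
rewrite {1}/qf -{1}[A]submxK tr_col_mx tr_scalar_mx mul_row_block mul_row_col.
rewrite mulmxDl mulmxDl ulsubmx00 cE' -[_ *m ursubmx A *m y]mulmxA cE.
rewrite -!scalar_mxM !mxE /= !mulr1n -/(qf _ _).
have -> : \sum_j (y^T *m drsubmx A) 0 j * y j 0 = qf (drsubmx A) y.
  by rewrite /qf mxE.
by field.
Qed.

Lemma col_mx_scalar_usub (v : 'cV[R]_(1 + n)) : v = col_mx (v 0 0)%:M (dsubmx v).
Proof.
rewrite -[LHS]vsubmxK; congr col_mx; rewrite [LHS]mx11_scalar; congr (_ %:M).
by rewrite !mxE; congr (v _ _); apply/val_inj.
Qed.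

Lemma posdef_schur A :
  posdefmx A <-> [/\ A^T = A, 0 < A 0 0 & posdefmx (schur A)].
Proof.
split=> [[At A0]|[At a0 [St S0]]].
- have a0 : 0 < A 0 0.
    have := A0 (col_mx 1%:M 0); rewrite -/(qf _ _).
    have -> : qf A (col_mx 1%:M 0) = A 0 0.
      rewrite /qf -{1}[A]submxK tr_col_mx trmx0 tr_scalar_mx mul_row_block.
      by rewrite !mul0mx !addr0 !mul1mx mul_row_col mulmx0 mulmx1 addr0 ulsubmx00 mxE.
    apply; apply/eqP => /(congr1 (fun u : 'cV_(1 + n) => u (lshift n 0) 0)).
    by rewrite col_mxEu !mxE eqxx => /eqP; rewrite oner_eq0.
  split => //; split.
    rewrite /schur linearB linearZ /= trmx_mul trmx_drsub trmx_dlsub trmx_ursub.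
    by rewrite At.
  (* This first coordinate minimises the form for given [y]: it cancels the square in [qf_schur]. *)
  move=> y y0; have := A0 (col_mx (- ((A 0 0)^-1 * (ursubmx A *m y) 0 0))%:M y).
  rewrite -/(qf _ _) qf_schur ?gt_eqF// addNr expr0n mulr0 add0r; apply.
  by apply: contra y0 => /eqP /(congr1 dsubmx); rewrite col_mxKd linear0 => ->.
- split => // v v0; rewrite -/(qf _ _) (col_mx_scalar_usub v) qf_schur ?gt_eqF//.
  have [d0|d0] := eqVneq (dsubmx v) 0; last first.
    by apply: ltr_wpDl; [rewrite mulr_ge0 ?sqr_ge0// ltW|exact: S0].
  rewrite d0 /qf !mulmx0 !mxE mulr0 !addr0 mulr_gt0// exprn_even_gt0//=.
  apply: contra v0 => /eqP v00; rewrite (col_mx_scalar_usub v) d0 v00.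
  by rewrite (_ : 0%:M = 0) ?col_mx0//; apply/matrixP=> i j; rewrite !mxE mul0rn.
Qed.

End schur.

Lemma posdef_det_gt0 n (A : 'M[R]_n) : posdefmx A -> 0 < \det A.
Proof.
elim: n => [|n IH] in A *; first by rewrite det_mx00.
move=> /(@posdef_schur n)[_ a0 pS].
by rewrite (@det_schur n) ?gt_eqF// mulr_gt0// IH.
Qed.

Lemma det_mxdiag n (k : 'I_n -> nat) (B : forall i, 'M[R]_(k i)) :
  \det (\mxdiag_i B i) = \prod_i \det (B i).
Proof.
elim: n => [|n IH] in k B *.
  rewrite [RHS]big_ord0; move: (\mxdiag_i B i).
  by rewrite big_ord0 => M; rewrite det_mx00.
rewrite mxdiag_recl [RHS]big_ord_recl -IH -(det_ublock (B 0) 0).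
(* The sizes on the two sides are only propositionally equal; eliminating [mxsize_recl] makes the
   cast trivial. *)
by case: _ / mxsize_recl; rewrite castmx_id.
Qed.

Lemma qf_mxdiag n (k : 'I_n -> nat) (B : forall i, 'M[R]_(k i)) v :
  qf (\mxdiag_i B i) v = \sum_i qf (B i) (submxcol v i).
Proof.
rewrite /qf -{1 2}[v]submxcolK tr_mxcol -mulmxA mul_mxdiag_mxcol mul_mxrow_mxcol.
by rewrite summxE; apply: eq_bigr => i _; rewrite mulmxA.
Qed.

Lemma posdef_mxdiag n (k : 'I_n -> nat) (B : forall i, 'M[R]_(k i)) :
  (forall i, posdefmx (B i)) -> posdefmx (\mxdiag_i B i).
Proof.
move=> pB; split.
  by rewrite tr_mxdiag; apply: eq_mxdiag => i; rewrite (pB i).1.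
move=> v v0; rewrite -/(qf _ _) qf_mxdiag lt_neqAle sumr_ge0 ?andbT; last first.
  by move=> i _; exact: posdef_qf_ge0.
apply: contra v0; rewrite eq_sym psumr_eq0; last by move=> i _; exact: posdef_qf_ge0.
move=> /allP q0; rewrite -[v]submxcolK; apply/eqP.
rewrite -[RHS](submxcolK 0); apply/eq_mxcol => i; rewrite submxcol0.
have := q0 i (mem_index_enum _); apply: contraTeq => /(pB i).2 h.
by rewrite gt_eqF.
Qed.

End quadratic_forms.

(** * Rayleigh quotients and extreme eigenvalues *)

Section rayleigh.
Context {R : realType} {n : nat}.
Implicit Type A : 'M[R]_n.

(** Stated on row vectors to match [EVT_min_rV]. *)
Lemma continuous_qf_tr A : continuous (fun u : 'rV[R]_n => qf A u^T).
Proof.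
move=> u; have -> : (fun u : 'rV[R]_n => qf A u^T) =
    (fun u => \sum_i \sum_j u 0 i * A i j * u 0 j).
  apply/funext => w; rewrite qfE; apply: eq_bigr => i _.
  by apply: eq_bigr => j _; rewrite !mxE.
move: u; apply: continuous_big => [|i _]; first exact: add_continuous.
apply: continuous_big => [|j _]; first exact: add_continuous.
move=> u; apply: (@continuousM R 'rV[R]_n (fun u => u 0 i * A i j) (fun u => u 0 j)).
  apply: (@continuousM R 'rV[R]_n (fun u => u 0 i) (fun=> A i j)).
    exact: coord_continuous.
  exact: cst_continuous.
exact: coord_continuous.
Qed.

Lemma sqn_tr_qf (u : 'rV[R]_n) : sqn u^T = qf 1%:M u^T.
Proof. by rewrite qf_scalar mul1r. Qed.

Lemma compact_sphere : compact [set u : 'rV[R]_n | sqn u^T = 1].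
Proof.
apply: bounded_closed_compact.
  exists 1; split => // M M1 u /= u1; rewrite /Num.norm/= mx_normrE.
  apply/bigmax_leP; split => [|[i j] _]; first by rewrite ltW// (lt_trans ltr01).
  rewrite (le_trans _ (ltW M1))//= -ler_sqr ?nnegrE// expr1n real_normK ?num_real//.
  rewrite -u1 /sqn (bigD1 j)//= mxE (ord1 i) lerDl sumr_ge0// => k _; exact: sqr_ge0.
rewrite [X in closed X](_ : _ = (fun u : 'rV[R]_n => qf 1%:M u^T) @^-1` [set 1]); last first.
  by apply/seteqP; split => u /=; rewrite sqn_tr_qf.
have /continuous_closedP := @continuous_qf_tr 1%:M.
by apply; exact: closed_eq.
Qed.

Lemma psd_isotropic A v : A^T = A -> (forall w, 0 <= qf A w) -> qf A v = 0 ->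
  A *m v = 0.
Proof.
move=> At A0 v0; set w := A *m v.
(* minimality of [t |-> qf (v - t w)] at [t = 0] *)
have h t : 0 <= - 2 * t * sqn w + t ^+ 2 * qf A w.
  have := A0 (v - t *: w); rewrite qfD// v0 qfN qfZ mulmxN -scalemxAr !mxE.
  rewrite (_ : \sum_j _ = sqn w); first lra.
  by rewrite sqnE /w trmx_mul At [RHS]mxE.
apply/eqP; rewrite -sqn_eq0.
move: (A0 w) (sqn_ge0 w) h; move: (qf A w) (sqn w) => a s a0 s0 h.
have a1 : 1 + a != 0 by rewrite gt_eqF// ltr_pwDl.
(* The minimiser would be [s / a], but [a] may be 0; adding 1 keeps the denominator positive, and
   the value is still negative unless [s = 0]. *)
have := h (s / (1 + a)).
have -> : - 2 * (s / (1 + a)) * s + (s / (1 + a)) ^+ 2 * a =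
    - (s ^+ 2 * ((2 + a) / (1 + a) ^+ 2)) by field.
rewrite oppr_ge0 pmulr_lle0; last by rewrite divr_gt0 ?exprn_gt0//; lra.
by rewrite le_eqVlt ltNge sqr_ge0 orbF sqrf_eq0.
Qed.

(** The form attains its minimum [a] over the unit sphere at some [u]. Then [A - a I] is positive
    semidefinite and isotropic at [u], so [psd_isotropic] makes [u] an eigenvector. As [rho_min] and
    [rho_max] are an infimum and a supremum over eigenvalues, this existence is what gives them
    content. *)
Lemma rayleigh_min A : (0 < n)%N -> A^T = A ->
  exists2 a, eigenvalue A a & forall v, a * sqn v <= qf A v.
Proof.
move=> n0 At.
have [] := @EVT_min_rV R n (fun u => qf A u^T) [set u : 'rV[R]_n | sqn u^T = 1] _ compact_sphere.
- exists (delta_mx 0 (Ordinal n0)) => /=.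
  rewrite /sqn (bigD1 (Ordinal n0))//= !mxE !eqxx expr1n big1 ?addr0// => k k0.
  by rewrite !mxE (negbTE k0) andbF expr0n.
- by apply: continuous_subspaceT; exact: continuous_qf_tr.
move=> u; rewrite inE /= => u1 umin.
have m v : qf A u^T * sqn v <= qf A v.
  have [->|v0] := eqVneq v 0; first by rewrite /qf !mulmx0 !mxE sqnE mulmx0 mxE mulr0.
  have sv := sqn_gt0 v0; pose c := (Num.sqrt (sqn v))^-1.
  have c2 : c ^+ 2 = (sqn v)^-1 by rewrite exprVn sqr_sqrtr// ltW.
  have := umin (c *: v)^T; rewrite inE /= trmxK qfZ c2.
  have -> : sqn (c *: v) = 1.
    by rewrite -[LHS]mul1r -qf_scalar qfZ c2 qf_scalar mul1r mulVf// gt_eqF.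
  by move=> /(_ erefl); rewrite ler_pdivlMl// mulrC.
exists (qf A u^T) => //; apply/eigenvalueP; exists u.
  set a := qf A u^T.
  have qB v : qf (A - a%:M) v = qf A v - a * sqn v.
    by rewrite qf_addmx -scalemx1 -scaleNr qf_scalemx qf_scalar; ring.
  have : (A - a%:M) *m u^T = 0.
    apply: psd_isotropic; first by rewrite linearB /= At tr_scalar_mx.
      by move=> w; rewrite qB subr_ge0.
    by rewrite qB u1 mulr1 subrr.
  rewrite mulmxBl mul_scalar_mx => /eqP; rewrite subr_eq0 => /eqP /(congr1 trmx).
  by rewrite trmx_mul trmxK At linearZ /= trmxK.
by apply/eqP => u0; move: u1; rewrite u0 trmx0 sqnE mulmx0 mxE => /esym/eqP; rewrite oner_eq0.
Qed.

Lemma eigenvalue_qf A a : eigenvalue A a -> A^T = A ->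
  exists2 v, v != 0 & qf A v = a * sqn v.
Proof.
move=> /eigenvalueP[u uA u0] At; exists u^T.
  by apply: contra u0 => /eqP /(congr1 trmx); rewrite trmxK trmx0 => ->.
by rewrite /qf trmxK uA -scalemxAl mxE sqnE trmxK.
Qed.

Lemma rho_min_le A v : (0 < n)%N -> A^T = A -> rho_min A * sqn v <= qf A v.
Proof.
move=> n0 At; have [a aA am] := rayleigh_min n0 At.
apply: le_trans (am v); apply: ler_wpM2r; first exact: sqn_ge0.
(* [ge_inf] asks for a lower bound of the eigenvalues; [a] is one, as testing on eigenvectors
   shows. *)
apply: ge_inf => //; exists a => b /= /eigenvalue_qf -/(_ At)[w w0 qw].
by have := am w; rewrite qw ler_pM2r// sqn_gt0.
Qed.

Lemma rho_max_ge A v : (0 < n)%N -> A^T = A -> qf A v <= rho_max A * sqn v.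
Proof.
move=> n0 At; have Ant : (- A)^T = - A by rewrite linearN /= At.
have qN w : qf (- A) w = - qf A w by rewrite -scaleN1r qf_scalemx mulN1r.
have [a aA am] := rayleigh_min n0 Ant.
have {}am w : qf A w <= - a * sqn w by have := am w; rewrite qN; lra.
apply: le_trans (am v) _; apply: ler_wpM2r; first exact: sqn_ge0.
apply: sup_ubound.
  exists (- a) => b /= /eigenvalue_qf -/(_ At)[w w0 qw].
  by have := am w; rewrite qw ler_pM2r// sqn_gt0.
move: aA => /eigenvalueP[u uA u0]; apply/eigenvalueP; exists u => //.
by rewrite scaleNr -uA mulmxN opprK.
Qed.

End rayleigh.

Lemma norm_sp_sqn (R : realType) m n (Z : 'M[R]_(m, n)) v : (0 < n)%N ->
  sqn (Z *m v) <= norm_sp Z ^+ 2 * sqn v.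
Proof.
move=> n0; have ZZ : (Z^T *m Z)^T = Z^T *m Z by rewrite trmx_mul trmxK.
have h w : sqn (Z *m w) = qf (Z^T *m Z) w by rewrite sqnE /qf trmx_mul !mulmxA.
have := rho_max_ge v n0 ZZ; rewrite h => /le_trans; apply.
(* [Num.sqrt] truncates negative arguments to 0. In the branch of a negative [rho_max] the right
   side is therefore 0 and the bound persists. *)
have [r0|r0] := leP 0 (rho_max (Z^T *m Z)); first by rewrite sqr_sqrtr.
rewrite /norm_sp ler0_sqrtr; last exact: ltW.
rewrite expr0n mul0r.
by apply: mulr_le0_ge0; [exact: ltW|exact: sqn_ge0].
Qed.

(** * Lebesgue measure and Gaussian integrals on R^n *)

Section measurable_mx.
Context {R : realType} d (T : measurableType d).

(** Measurability is read entrywise, with no sigma-algebra on matrices. *)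
Definition measurable_mx m n (F : T -> 'M[R]_(m, n)) :=
  forall i j, measurable_fun setT (fun t => F t i j).

Lemma measurable_mx_cst m n (A : 'M[R]_(m, n)) : measurable_mx (fun=> A).
Proof. by move=> i j; exact: measurable_cst. Qed.

Lemma measurable_mx_mul m n k (F : T -> 'M[R]_(m, n)) (G : T -> 'M[R]_(n, k)) :
  measurable_mx F -> measurable_mx G -> measurable_mx (fun t => F t *m G t).
Proof.
move=> mF mG i j; under eq_fun do rewrite mxE.
by apply: measurable_sum => l; exact: measurable_funM.
Qed.

Lemma measurable_mx_add m n (F G : T -> 'M[R]_(m, n)) :
  measurable_mx F -> measurable_mx G -> measurable_mx (fun t => F t + G t).
Proof.
by move=> mF mG i j; under eq_fun do rewrite mxE; exact: measurable_funD.
Qed.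

Lemma measurable_mx_scale m n (c : T -> R) (F : T -> 'M[R]_(m, n)) :
  measurable_fun setT c -> measurable_mx F -> measurable_mx (fun t => c t *: F t).
Proof.
by move=> mc mF i j; under eq_fun do rewrite mxE; exact: measurable_funM.
Qed.

Lemma measurable_mx_opp m n (F : T -> 'M[R]_(m, n)) :
  measurable_mx F -> measurable_mx (fun t => - F t).
Proof.
move=> mF; under eq_fun do rewrite -scaleN1r.
by apply: measurable_mx_scale => //; exact: measurable_cst.
Qed.

Lemma measurable_mx_tr m n (F : T -> 'M[R]_(m, n)) :
  measurable_mx F -> measurable_mx (fun t => (F t)^T).
Proof. by move=> mF i j; under eq_fun do rewrite mxE; exact: mF. Qed.

Lemma measurable_det n (F : T -> 'M[R]_n) :
  measurable_mx F -> measurable_fun setT (fun t => \det (F t)).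
Proof.
move=> mF; apply: measurable_sum => s; apply: measurable_funM; first exact: measurable_cst.
by apply: measurable_prod => i _; exact: mF.
Qed.

Lemma measurable_adj n (F : T -> 'M[R]_n) :
  measurable_mx F -> measurable_mx (fun t => \adj (F t)).
Proof.
move=> mF i j; under eq_fun do rewrite mxE /cofactor.
apply: measurable_funM; first exact: measurable_cst.
by apply: measurable_det => k l; under eq_fun do rewrite !mxE; exact: mF.
Qed.

Lemma measurable_invr (g : T -> R) :
  measurable_fun setT g -> measurable_fun setT (fun t => (g t)^-1).
Proof.
(* The square makes the base of [powR] nonnegative; where [g] vanishes both sides are 0, as
   [0^-1 = 0]. *)
move=> mg; rewrite (_ : (fun _ => _) = fun t => g t * (g t ^+ 2) `^ (-1)); last first.
  apply/funext => t; rewrite powR_inv1 ?sqr_ge0// expr2 invfM.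
  have [->|g0] := eqVneq (g t) 0; first by rewrite invr0 mul0r.
  by rewrite mulrA divff// mul1r.
apply: measurable_funM => //; apply: measurableT_comp (measurable_powR _) _.
exact: measurable_funX.
Qed.

Lemma measurable_invmx n (F : T -> 'M[R]_n) :
  measurable_mx F -> measurable_mx (fun t => invmx (F t)).
Proof.
move=> mF i j; under eq_fun do rewrite /invmx unitmxE unitfE.
(* [invmx] returns its argument unchanged on singular matrices, hence the second branch. *)
rewrite (_ : (fun _ => _) = (fun t => if \det (F t) != 0
  then ((\det (F t))^-1 *: \adj (F t)) i j else F t i j)); last first.
  by apply/funext => t; case: ifP.
apply: measurable_fun_ifT.
- rewrite [X in measurable_fun _ X](_ : _ = fun t => ~~ (\det (F t) == 0))//.
  apply: measurable_neg; apply: measurable_fun_eqr => //; exact: measurable_det.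
- apply: measurable_mx_scale; last exact: measurable_adj.
  by apply: measurable_invr; exact: measurable_det.
- exact: mF.
Qed.

Lemma measurable_qf n (F : T -> 'M[R]_n) (v : T -> 'cV[R]_n) :
  measurable_mx F -> measurable_mx v -> measurable_fun setT (fun t => qf (F t) (v t)).
Proof.
move=> mF mv; apply: (measurable_mx_mul _ mv).
by apply: measurable_mx_mul => //; exact: measurable_mx_tr.
Qed.

(** By [posdef_schur] the condition splits into the sign of the pivot and positivity of the Schur
    complement, whose entries are again measurable and whose dimension is one lower. *)
Lemma measurable_posdef n (F : T -> 'M[R]_n) :
  measurable_mx F -> (forall t, (F t)^T = F t) ->
  measurable [set t | posdefmx (F t)].
Proof.
elim: n => [|n IH] in F *.
  move=> _ Ft; rewrite (_ : mkset _ = setT)//; apply/seteqP; split => // t _ /=.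
  by split => // v /negP[]; apply/eqP/colP => -[].
move=> mF Ft.
rewrite (_ : mkset _ = (fun t => 0 < F t 0 0) @^-1` [set true] `&`
    [set t | posdefmx (@schur R n (F t))]); last first.
  by apply/seteqP; split => t /=; rewrite (@posdef_schur _ n) => -[].
apply: measurableI.
  rewrite -[X in measurable X]setTI; apply: measurable_fun_ltr => //.
apply: IH => [|t].
  apply: measurable_mx_add; first by move=> i j; under eq_fun do rewrite !mxE; exact: mF.
  apply: measurable_mx_opp; apply: measurable_mx_scale; first exact/measurable_invr/mF.
  by apply: measurable_mx_mul => i j; under eq_fun do rewrite !mxE; exact: mF.
by rewrite /schur linearB linearZ /= trmx_mul trmx_drsub trmx_dlsub trmx_ursub Ft.
Qed.

End measurable_mx.

Section lebesgue_tuple_theory.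
Context {R : realType}.

(* [lebesgue_tuple n] under a head constant to which the sigma-finite structure
   can be attached *)
Definition leb n : set (n.-tuple R) -> \bar R := lebesgue_tuple n.

HB.instance Definition _ n := Measure.copy (@leb n) (lebesgue_tuple n).

Definition box n (a : 'I_n -> R) (h : R) : set (n.-tuple R) :=
  [set x | forall k, `|tnth x k - a k| <= h].

Lemma measurable_box n (a : 'I_n -> R) h : measurable (box a h).
Proof.
rewrite (_ : box a h = \bigcap_(k : 'I_n)
    ((@tnth n R ^~ k) @^-1` `[a k - h, a k + h])); last first.
  apply/seteqP; split => x /= xa k => [_|]; have := xa k; rewrite /= in_itv/=.
    by rewrite ler_distl.
  by rewrite ler_distl; apply.
apply: fin_bigcap_measurable => // k _; rewrite -[X in measurable X]setTI.
exact: measurable_tnth.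
Qed.

Lemma tnth_tcons0 n z : tnth (@tcons R n z) ord0 = z.1.
Proof. by []. Qed.

Lemma tnth_tconsS n z k : tnth (@tcons R n z) (lift ord0 k) = tnth z.2 k.
Proof. by rewrite /tcons tnthS. Qed.

Lemma leb_box n (a : 'I_n -> R) h : 0 <= h -> leb (box a h) = ((2 * h) ^+ n)%:E.
Proof.
move=> h0; elim: n => [|n IH] in a *.
  rewrite /leb /= diracE expr0 mem_set// => -[]//.
rewrite /leb /= /lebesgue_cons /pushforward.
rewrite (_ : _ @^-1` _ = `[a ord0 - h, a ord0 + h]%classic `*`
    box (fun k => a (lift ord0 k)) h); last first.
  apply/seteqP; split => [[x y] /= xa|[x y] /= [xa ya] k].
    split; first by have := xa ord0; rewrite tnth_tcons0 ler_distl in_itv.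
    by move=> k; have := xa (lift ord0 k); rewrite tnth_tconsS.
  case: (unliftP ord0 k) => [j ->|->]; first by rewrite tnth_tconsS.
  by rewrite tnth_tcons0 ler_distl; rewrite in_itv in xa.
rewrite product_measure2E//; last exact: measurable_box.
rewrite -[lebesgue_tuple n _]/(leb _) IH exprS EFinM; congr (_ * _)%E.
etransitivity; first exact: lebesgue_measure_itv.
rewrite /= lte_fin; case: ifPn => [_|].
  by rewrite -EFinB; congr EFin; ring.
by rewrite -leNgt => h'; congr EFin; lra.
Qed.

Let leb_sigma_finite n : sigma_finite setT (@leb n).
Proof.
exists (fun i => box (fun=> 0) i%:R).
  apply/seteqP; split => // x _.
  have [i hi] : exists i : nat, forall k, `|tnth x k| <= i%:R.
    exists (\max_(k < n) (Num.trunc `|tnth x k|).+1) => k.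
    rewrite (le_trans (ltW (truncnS_gt _)))// ler_nat.
    exact: (leq_bigmax k).
  by exists i => // k; rewrite subr0.
move=> i; split; first exact: measurable_box.
by rewrite leb_box// ltry.
Qed.

HB.instance Definition _ n := Measure_isSigmaFinite.Build _ _ _ (@leb n)
  (@leb_sigma_finite n).

(** [lebesgue_cons] is built from the product [\x^], while Tonelli is applied to [\x]; the two
    measures coincide because they agree on rectangles. *)
Lemma integral_lebS n (F : n.+1.-tuple R -> \bar R) :
  measurable_fun setT F -> (forall x, 0 <= F x)%E ->
  (\int[@leb n.+1]_x F x =
   \int[@leb n]_y \int[lebesgue_measure]_x F (tcons (x, y)))%E.
Proof.
move=> mF F0.
rewrite [LHS](@ge0_integral_pushforward _ _ (measurableTypeR R * n.-tuple R)%type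
  (n.+1.-tuple R) R _ (@measurable_tcons R n) (lebesgue_measure \x^ @leb n)%E setT F)//.
rewrite preimage_setT (eq_measure_integral (lebesgue_measure \x @leb n)%E); last first.
  move=> A mA _; apply/esym.
  apply: (@product_measure_unique _ _ _ _ R lebesgue_measure (@leb n)
    (lebesgue_measure \x^ @leb n)%E) => // *.
  exact: product_measure2E.
apply: (@fubini_tonelli2 _ _ (measurableTypeR R) (n.-tuple R) R lebesgue_measure
  (@leb n) (F \o @tcons R n)) => [|x]; last exact: F0.
apply: measurableT_comp => //; exact: measurable_tcons.
Qed.

Lemma integral_leb_prod n (phi : R -> R) : measurable_fun setT phi ->
  (forall x, 0 <= phi x) -> (\int[lebesgue_measure]_x (phi x)%:E = 1)%E ->
  (\int[@leb n]_x (\prod_(k < n) phi (tnth x k))%:E = 1)%E.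
Proof.
move=> mphi phi0 phi1.
have mP m : measurable_fun setT (fun x : m.-tuple R => \prod_(k < m) phi (tnth x k)).
  apply: measurable_prod => k _; apply: measurableT_comp => //; exact: measurable_tnth.
elim: n => [|n IH].
  under eq_integral do rewrite big_ord0.
  by rewrite integral_cst//= mul1e /leb /= diracT.
rewrite integral_lebS; last 2 first.
- by apply/measurable_EFinP; exact: mP.
- by move=> x; rewrite lee_fin prodr_ge0.
rewrite -[RHS]IH; apply: eq_integral => y _.
under eq_integral.
  move=> x _; rewrite big_ord_recl tnth_tcons0 /= mulrC EFinM.
  under eq_bigr do rewrite tnth_tconsS /=.
  over.
rewrite ge0_integralZl_EFin ?phi1 ?mule1//.
- by move=> x _; rewrite lee_fin.
- exact/measurable_EFinP.
- by rewrite prodr_ge0.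
Qed.

Definition col_of_tuple n (x : n.-tuple R) : 'cV[R]_n := \col_k tnth x k.

Lemma measurable_col_of_tuple n : measurable_mx (@col_of_tuple n).
Proof. by move=> i j; under eq_fun do rewrite mxE; exact: measurable_tnth. Qed.

Lemma col_of_tuple_tcons n (x : R) (y : n.-tuple R) :
  col_of_tuple (tcons (x, y)) = col_mx x%:M (col_of_tuple y) :> 'cV_(1 + n).
Proof.
apply/colP => i; rewrite [LHS]mxE; case: (split_ordP i) => j ->.
  rewrite col_mxEu (ord1 j) mxE eqxx mulr1n.
  by rewrite (_ : lshift n 0 = ord0)//; exact/val_inj.
rewrite col_mxEd mxE (_ : rshift 1 j = lift ord0 j) ?tnth_tconsS//.
exact/val_inj.
Qed.

Lemma col_mx_scalar_sub n (a : R) (y : 'cV[R]_n) (mu : 'cV[R]_(1 + n)) :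
  col_mx a%:M y - mu = col_mx (a - mu 0 0)%:M (y - dsubmx mu).
Proof.
apply/matrixP => i j; case: (split_ordP i) => k ->.
  rewrite mxE !col_mxEu !mxE (ord1 k) (ord1 j) !mulr1n (_ : lshift n 0 = 0)//.
  exact/val_inj.
by rewrite mxE !col_mxEd !mxE.
Qed.

Lemma integral_gauss1 (a m : R) : 0 < a ->
  (\int[lebesgue_measure]_x (expR (- (a * (x - m) ^+ 2) / 2))%:E =
   (Num.sqrt (2 * pi / a))%:E)%E.
Proof.
move=> a0; pose s := (Num.sqrt a)^-1.
have s0 : s != 0 by rewrite invr_neq0// gt_eqF// sqrtr_gt0.
have s2 : s ^+ 2 = a^-1 by rewrite exprVn sqr_sqrtr// ltW.
have c0 : Num.sqrt (2 * pi / a) != 0.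
  by rewrite gt_eqF// sqrtr_gt0 divr_gt0// mulr_gt0// pi_gt0.
transitivity (\int[lebesgue_measure]_x
    ((Num.sqrt (2 * pi / a))%:E * (normal_pdf m s x)%:E))%E.
  apply: eq_integral => x _; rewrite -EFinM normal_pdfE// /normal_peak /normal_fun s2.
  have -> : a^-1 * pi *+ 2 = 2 * pi / a by rewrite -mulr_natl; ring.
  rewrite mulVKf//; congr (expR _)%:E.
  by rewrite -mulr_natl; field; rewrite gt_eqF.
rewrite ge0_integralZl_EFin ?integral_normal_pdf ?mule1//.
- by move=> x _; rewrite lee_fin normal_pdf_ge0.
- by apply/measurable_EFinP; exact: measurable_normal_pdf.
Qed.

Lemma measurable_gauss n (A : 'M[R]_n) mu :
  measurable_fun setT (fun x : n.-tuple R => expR (- qf A (col_of_tuple x - mu) / 2)).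
Proof.
apply: measurableT_comp => //; apply: measurable_funM => //.
apply: measurableT_comp => //; apply: measurable_qf; first exact: measurable_mx_cst.
by apply: measurable_mx_add; [exact: measurable_col_of_tuple|exact: measurable_mx_cst].
Qed.

Lemma integral_gauss n (A : 'M[R]_n) mu : posdefmx A ->
  (\int[@leb n]_x (expR (- qf A (col_of_tuple x - mu) / 2))%:E =
   (Num.sqrt ((2 * pi) ^+ n / \det A))%:E)%E.
Proof.
elim: n => [|n IH] in A mu *.
  move=> _; under eq_integral => x _.
    rewrite (_ : col_of_tuple x - mu = 0); last by apply/colP => -[].
    rewrite /qf mulmx0 mxE oppr0 mul0r expR0; over.
  by rewrite integral_cst//= mul1e /leb /= diracT det_mx00 expr0 divr1 sqrtr1.
move=> pA; have [At a0 pS] := (@posdef_schur _ n A).1 pA.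
rewrite integral_lebS; last 2 first.
- by apply/measurable_EFinP; exact: measurable_gauss.
- by move=> x; rewrite lee_fin expR_ge0.
set S := @schur R n A in pS *; set mu' := dsubmx (mu : 'cV[R]_(1 + n)).
transitivity (\int[@leb n]_y ((Num.sqrt (2 * pi / A 0 0))%:E *
    (expR (- qf S (col_of_tuple y - mu') / 2))%:E))%E.
  apply: eq_integral => y _.
  (* Conditional mean of the first coordinate given the others, for the precision matrix [A]. *)
  pose m := mu 0 0 - (A 0 0)^-1 * (ursubmx (A : 'M[R]_(1 + n)) *m (col_of_tuple y - mu')) 0 0.
  rewrite -(integral_gauss1 m a0) muleC -ge0_integralZl_EFin; last 4 first.
  - exact: measurableT.
  - by move=> x _; rewrite lee_fin expR_ge0.
  - apply/measurable_EFinP; apply: measurableT_comp => //.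
    apply: measurable_funM => //; apply: measurableT_comp => //.
    apply: measurable_funM => //; apply: measurable_funX => //.
    exact: measurable_funB.
  - exact: expR_ge0.
  apply: eq_integral => x _; rewrite -EFinM -expRD; congr (expR _)%:E.
  rewrite col_of_tuple_tcons.
  rewrite (_ : _ - mu = col_mx (x - mu 0 0)%:M (col_of_tuple y - mu')); last first.
    exact: col_mx_scalar_sub.
  rewrite (@qf_schur _ n) ?gt_eqF// -/S /m.
  by field; rewrite gt_eqF.
rewrite ge0_integralZl_EFin//; last by apply/measurable_EFinP; exact: measurable_gauss.
rewrite IH// -EFinM -sqrtrM; last by rewrite divr_ge0 ?mulr_ge0 ?pi_ge0 ?ltW.
congr (Num.sqrt _)%:E; rewrite (@det_schur _ n) ?gt_eqF// exprS invfM -/S.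
by rewrite mulrACA.
Qed.

End lebesgue_tuple_theory.

(** * Gaussian densities in terms of the precision matrix *)

Section gaussian.
Context {R : realType}.

(** Normalising constant of the density whose precision matrix, not covariance, is [A]. *)
Definition gauss_const n (A : 'M[R]_n) : R := (Num.sqrt ((2 * pi) ^+ n / \det A))^-1.

Lemma gauss_const_gt0 n (A : 'M[R]_n) : posdefmx A -> 0 < gauss_const A.
Proof.
move=> pA; rewrite invr_gt0 sqrtr_gt0 divr_gt0 ?posdef_det_gt0//.
by rewrite exprn_gt0// mulr_gt0// pi_gt0.
Qed.

(** A larger form has a smaller Gaussian integral, and this integral is a decreasing function of the
    determinant. *)
Lemma det_posdef_le n (A B : 'M[R]_n) : posdefmx A -> posdefmx B ->
  (forall v, qf A v <= qf B v) -> \det A <= \det B.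
Proof.
move=> pA pB AB.
have dA := posdef_det_gt0 pA; have dB := posdef_det_gt0 pB.
have : ((Num.sqrt ((2 * pi) ^+ n / \det B))%:E <= (Num.sqrt ((2 * pi) ^+ n / \det A))%:E)%E.
  rewrite -(integral_gauss 0 pA) -(integral_gauss 0 pB); apply: ge0_le_integral => //.
  - by apply/measurable_EFinP; exact: measurable_gauss.
  - by apply/measurable_EFinP; exact: measurable_gauss.
  - move=> x _; rewrite lee_fin ler_expR ler_pM2r// lerN2; exact: AB.
have p0 : 0 < (2 * pi) ^+ n :> R by rewrite exprn_gt0// mulr_gt0// pi_gt0.
rewrite lee_fin ler_psqrt ?nnegrE ?divr_ge0 ?(ltW dA) ?(ltW dB) ?(ltW p0)//.
by rewrite ler_pM2l// lef_pV2.
Qed.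

Lemma integral_gauss_density n (A : 'M[R]_n) mu : posdefmx A ->
  (\int[@leb R n]_x (gauss_const A * expR (- qf A (col_of_tuple x - mu) / 2))%:E = 1)%E.
Proof.
move=> pA; under eq_integral do rewrite EFinM.
rewrite ge0_integralZl_EFin ?integral_gauss//; last 2 first.
- by apply/measurable_EFinP; exact: measurable_gauss.
- exact/ltW/gauss_const_gt0.
rewrite -EFinM mulVf// gt_eqF// -invr_gt0; exact: gauss_const_gt0.
Qed.

Lemma gauss_const_half n (A : 'M[R]_n) : posdefmx A ->
  gauss_const A = Num.sqrt 2 ^+ n * gauss_const (2^-1 *: A).
Proof.
move=> pA; have dA := posdef_det_gt0 pA.
have p0 : 0 < (2 * pi) ^+ n :> R by rewrite exprn_gt0// mulr_gt0// pi_gt0.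
have s2 : Num.sqrt 2 ^+ n = Num.sqrt (2 ^+ n) :> R.
  by apply/esym; elim: n {A pA dA p0} => [|n IH]; rewrite ?expr0 ?sqrtr1// !exprS sqrtrM// IH.
have p2 : 0 < 2 ^+ n :> R by rewrite exprn_gt0.
rewrite /gauss_const detZ s2.
have -> : (2 * pi) ^+ n / (2^-1 ^+ n * \det A) = 2 ^+ n * ((2 * pi) ^+ n / \det A).
  by rewrite exprVn invfM invrK; ring.
by rewrite (sqrtrM _ (ltW p2)) invfM mulVKf// gt_eqF// sqrtr_gt0.
Qed.

Lemma measurable_gauss_tail n (A : 'M[R]_n) mu t :
  measurable_fun setT (fun x : n.-tuple R => (if (t < qf A (col_of_tuple x - mu))%R
    then gauss_const A * expR (- qf A (col_of_tuple x - mu) / 2) else 0)%:E).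
Proof.
apply/measurable_EFinP; apply: measurable_fun_ifT => //.
  apply: measurable_fun_ltr => //; apply: measurable_qf; first exact: measurable_mx_cst.
  by apply: measurable_mx_add; [exact: measurable_col_of_tuple|exact: measurable_mx_cst].
by apply: measurable_funM => //; exact: measurable_gauss.
Qed.

(* Chernoff bound with exponent 1/4: tilting the density only halves the precision
   matrix *)
Lemma gauss_tail n (A : 'M[R]_n) mu t : posdefmx A ->
  (\int[@leb R n]_x (if (t < qf A (col_of_tuple x - mu))%R
    then gauss_const A * expR (- qf A (col_of_tuple x - mu) / 2) else 0)%:E
   <= (Num.sqrt 2 ^+ n * expR (- (t / 4)))%:E)%E.
Proof.
move=> pA; have pA2 : posdefmx (2^-1 *: A).
  split; first by rewrite linearZ /= pA.1.
  by move=> v v0; rewrite -/(qf _ _) qf_scalemx mulr_gt0//; exact: pA.2.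
have m2 := measurable_gauss (2^-1 *: A) mu.
rewrite -[leRHS]mule1 -(integral_gauss_density mu pA2) -ge0_integralZl_EFin//; last 2 first.
- by move=> x _; rewrite lee_fin mulr_ge0 ?expR_ge0// ltW// gauss_const_gt0.
- by apply/measurable_EFinP; apply: measurable_funM.
apply: ge0_le_integral => //.
- move=> x _; rewrite lee_fin; case: ifP => // _.
  by rewrite mulr_ge0 ?expR_ge0// ltW//; exact: gauss_const_gt0.
- exact: measurable_gauss_tail.
- apply/measurable_EFinP; apply: measurable_funM => //; exact: measurable_funM.
- move=> x _; rewrite -EFinM lee_fin; case: ifP => [tq|_]; last first.
    by rewrite !mulr_ge0 ?exprn_ge0 ?expR_ge0// ltW// gauss_const_gt0.
  rewrite gauss_const_half// -!mulrA ler_pM2l ?exprn_gt0 ?sqrtr_gt0//.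
  rewrite [leRHS]mulrCA ler_pM2l ?gauss_const_gt0// qf_scalemx.
  by rewrite -expRD ler_expR; lra.
Qed.

End gaussian.

(** * The likelihood ratio *)

Section model_theory.
Context {R : realType} {q p r n : nat}.
Variables (f : 'cV[R]_q -> R -> R) (sigma2 : R) (D : design R p r n).
Hypothesis sigma2_gt0 : 0 < sigma2.
Implicit Types (G : 'M[R]_r) (beta : 'cV[R]_(q * p)).

Lemma qf_Delta G i v :
  qf (Delta sigma2 D G i) v = qf G ((random_design D i)^T *m v) + sigma2 * sqn v.
Proof. by rewrite /Delta qf_addmx qf_congr qf_scalar. Qed.

Lemma Delta_posdef G i : posdefmx G -> posdefmx (Delta sigma2 D G i).
Proof.
move=> pG; apply: (posdef_ge (posdef_scalar _ sigma2_gt0)).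
  by rewrite /Delta linearD /= !trmx_mul trmxK tr_scalar_mx pG.1 mulmxA.
by move=> v; rewrite qf_Delta qf_scalar lerDr posdef_qf_ge0.
Qed.

(** Stacking the subjects turns the product of densities into a single Gaussian density with
    block-diagonal precision matrix. *)
Definition precision G := \mxdiag_i invmx (Delta sigma2 D G i).
Definition mean_vec beta := \mxcol_i reg_mean f D beta i.

Lemma precision_posdef G : posdefmx G -> posdefmx (precision G).
Proof.
by move=> pG; apply: posdef_mxdiag => i; exact/posdef_invmx/Delta_posdef.
Qed.

Lemma qf_precision G beta (y : sample D) :
  qf (precision G) (col_of_tuple y - mean_vec beta) =
  \sum_i qf (invmx (Delta sigma2 D G i)) (obs y i - reg_mean f D beta i).
Proof.
by rewrite qf_mxdiag; apply: eq_bigr => i _; rewrite submxcolB mxcolK.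
Qed.

Lemma sqrtr_prod (I : finType) (F : I -> R) : (forall i, 0 <= F i) ->
  Num.sqrt (\prod_i F i) = \prod_i Num.sqrt (F i).
Proof.
move=> F0; suff [] : 0 <= \prod_i F i /\ Num.sqrt (\prod_i F i) = \prod_i Num.sqrt (F i) by [].
elim/big_ind2: _ => [|x1 x2 y1 y2 [x10 <-] [y10 <-]|i _]; rewrite ?sqrtr1//.
by rewrite mulr_ge0 ?sqrtrM.
Qed.

Lemma pdfE beta G (y : sample D) : posdefmx G ->
  pdf f sigma2 beta G y = gauss_const (precision G) *
    expR (- qf (precision G) (col_of_tuple y - mean_vec beta) / 2).
Proof.
move=> pG; rewrite /pdf /pdf_i /gauss_pdf big_split /=; congr (_ * _).
  rewrite prodfV; congr (_^-1).
  rewrite det_mxdiag -prodrXr -prodf_div.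
  rewrite sqrtr_prod; last first.
    move=> i; rewrite divr_ge0 ?exprn_ge0 ?mulr_ge0 ?pi_ge0// ltW//.
    exact/posdef_det_gt0/posdef_invmx/Delta_posdef.
  by apply: eq_bigr => i _; rewrite det_inv invrK.
rewrite qf_precision -expR_sum; congr expR.
by rewrite -sumrN mulr_suml.
Qed.

Lemma integral_pdf beta G : posdefmx G ->
  (\int[@leb R _]_(y in setT) (pdf f sigma2 (D := D) beta G y)%:E = 1)%E.
Proof.
move=> pG; rewrite -(integral_gauss_density (mean_vec beta) (precision_posdef pG)).
by apply: eq_integral => y _; rewrite pdfE.
Qed.

Lemma pdf_gt0 beta G (y : sample D) : posdefmx G -> 0 < pdf f sigma2 beta G y.
Proof.
move=> pG; rewrite pdfE// mulr_gt0 ?expR_gt0//.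
exact/gauss_const_gt0/precision_posdef.
Qed.

Lemma lik_ratioE beta0 G0 beta G (y : sample D) :
  lik_ratio f sigma2 beta0 G0 beta G y =
  pdf f sigma2 beta G y / pdf f sigma2 beta0 G0 y.
Proof. by rewrite /lik_ratio prodf_div. Qed.

End model_theory.

(** Arithmetic closing [lik_ratio_ge]: [e] compensates the loss on normalising constants, and the
    factor 1/2 available on [b + c] is given away. *)
Lemma half_exponent_le (R : realFieldType) (x y b c e : R) :
  0 <= b + c -> x <= y + b + c -> e + (- (e + b + c) + - y / 2) <= - x / 2.
Proof. by move=> bc xy; lra. Qed.

Section likelihood_ratio.
Context {R : realType} {q p r n : nat}.
Variables (f : 'cV[R]_q -> R -> R) (sigma2 : R) (D : design R p r n).
Hypothesis sigma2_gt0 : 0 < sigma2.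
Implicit Types (G : 'M[R]_r) (beta : 'cV[R]_(q * p)).
Let N := (\sum_(i < n) nobs D i)%N.

Lemma qf_precision_anti G0 G v : posdefmx G0 -> posdefmx G ->
  (forall w, qf G0 w <= qf G w) ->
  qf (precision sigma2 D G) v <= qf (precision sigma2 D G0) v.
Proof.
move=> pG0 pG G0G; rewrite !qf_mxdiag; apply: ler_sum => i _.
apply: qf_invmx_le => [||w]; try exact: Delta_posdef.
by rewrite !qf_Delta lerD2r.
Qed.

(** The noise part [sigma2 I] of [Delta] for [G0] absorbs the excess [tau Z Z^T], so the covariance
    under [G] is at most a multiple of that under [G0]; inversion reverses the comparison. *)
Lemma qf_precision_scale G0 G (tau zeta : R) v : posdefmx G0 -> posdefmx G ->
  0 <= tau -> (forall i w, sqn ((random_design D i)^T *m w) <= zeta ^+ 2 * sqn w) ->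
  (forall w, qf G w <= qf G0 w + tau * sqn w) ->
  qf (precision sigma2 D G0) v <=
  (1 + zeta ^+ 2 * tau / sigma2) * qf (precision sigma2 D G) v.
Proof.
move=> pG0 pG tau0 Zz GG0; set c := 1 + _.
have a0 : 0 <= zeta ^+ 2 * tau / sigma2.
  by apply: divr_ge0; [apply: mulr_ge0 => //; exact: sqr_ge0|exact: ltW].
have c0 : 0 < c by rewrite /c ltr_pwDl.
rewrite !qf_mxdiag mulr_sumr; apply: ler_sum => i _.
set A := Delta sigma2 D G0 i; have pA : posdefmx A by exact: Delta_posdef.
have pcA : posdefmx (c *: A).
  split; first by rewrite linearZ /= pA.1.
  by move=> w w0; rewrite -/(qf _ _) qf_scalemx mulr_gt0//; exact: pA.2.
have : qf (invmx (c *: A)) (submxcol v i) <=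
    qf (invmx (Delta sigma2 D G i)) (submxcol v i).
  apply: qf_invmx_le => [||w]; [exact: Delta_posdef|by []|].
  rewrite qf_scalemx /A !qf_Delta; set w' := _ *m w.
  have h1 := GG0 w'; have h2 := Zz i w; rewrite -/w' in h2.
  have h3 : tau * sqn w' <= zeta ^+ 2 * tau / sigma2 * (sigma2 * sqn w).
    have -> : zeta ^+ 2 * tau / sigma2 * (sigma2 * sqn w) = tau * (zeta ^+ 2 * sqn w).
      by field; rewrite gt_eqF.
    exact: ler_wpM2l.
  have h4 : 0 <= zeta ^+ 2 * tau / sigma2 * qf G0 w' by rewrite mulr_ge0// posdef_qf_ge0.
  rewrite /c; lra.
rewrite invmxZ ?posdef_unitmx// qf_scalemx ler_pdivrMl//.
Qed.

Lemma qf_precision_ub G v : posdefmx G ->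
  qf (precision sigma2 D G) v <= sigma2^-1 * sqn v.
Proof.
move=> pG; rewrite qf_mxdiag.
have -> : sqn v = \sum_i sqn (submxcol v i).
  rewrite sqnE -{1 2}[v]submxcolK tr_mxcol mul_mxrow_mxcol summxE.
  by apply: eq_bigr => i _; rewrite sqnE.
rewrite mulr_sumr; apply: ler_sum => i _.
have := @qf_invmx_le R _ sigma2%:M (Delta sigma2 D G i) (submxcol v i)
  (posdef_scalar _ sigma2_gt0) (Delta_posdef D sigma2_gt0 i pG).
rewrite invmx_scalar qf_scalar; apply => w.
by rewrite qf_Delta qf_scalar lerDr posdef_qf_ge0.
Qed.

Lemma sqn_mean_vec beta beta0 (e : R) :
  (forall i j, `|reg_mean f D beta i j 0 - reg_mean f D beta0 i j 0| <= e) ->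
  sqn (mean_vec f D beta0 - mean_vec f D beta) <= N%:R * e ^+ 2.
Proof.
move=> be; have -> : N%:R * e ^+ 2 = \sum_(s < N) e ^+ 2.
  by rewrite sumr_const card_ord mulr_natl.
apply: ler_sum => s _; rewrite !mxE -real_normK ?num_real//.
rewrite ler_sqr ?nnegrE//; last exact: le_trans (be (tagnat.sig1 s) (tagnat.sig2 s)).
by rewrite distrC; have := be (tagnat.sig1 s) (tagnat.sig2 s); rewrite !mxE.
Qed.

Lemma gauss_const_le m (A B : 'M[R]_m) (a : R) : posdefmx A -> posdefmx B -> 0 <= a ->
  (forall v, qf A v <= (1 + a) * qf B v) ->
  gauss_const A <= expR (m%:R * a) * gauss_const B.
Proof.
move=> pA pB a0 AB; have dA := posdef_det_gt0 pA; have dB := posdef_det_gt0 pB.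
have a1 : 0 < 1 + a by rewrite ltr_pwDl.
have pcB : posdefmx ((1 + a) *: B).
  split; first by rewrite linearZ /= pB.1.
  by move=> w w0; rewrite -/(qf _ _) qf_scalemx mulr_gt0//; exact: pB.2.
have : \det A <= (1 + a) ^+ m * \det B.
  by rewrite -detZ; apply: det_posdef_le => // v; rewrite qf_scalemx.
have e1 : 1 <= expR (m%:R * a) by rewrite -[leLHS]expR0 ler_expR mulr_ge0.
have : (1 + a) ^+ m <= expR (m%:R * a).
  by rewrite expRM_natl lerXn2r ?nnegrE ?expR_ge0 ?(ltW a1)// expR_ge1Dx.
move: e1; set E := expR _ => e1 cE dAB.
have E0 : 0 < E by exact: lt_le_trans e1.
have p0 : 0 < (2 * pi) ^+ m :> R by rewrite exprn_gt0// mulr_gt0// pi_gt0.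
rewrite /gauss_const -[E]invrK -invfM lef_pV2 ?posrE; last 2 first.
- by rewrite sqrtr_gt0 divr_gt0.
- by rewrite mulr_gt0 ?invr_gt0// sqrtr_gt0 divr_gt0.
rewrite ler_pdivrMl// -[E]ger0_norm ?(ltW E0)// -sqrtr_sqr -sqrtrM ?sqr_ge0//.
rewrite ler_psqrt ?nnegrE ?divr_ge0 ?mulr_ge0 ?sqr_ge0 ?(ltW p0) ?(ltW dA) ?(ltW dB)//.
rewrite mulrCA ler_pM2l// ler_pdivlMr// mulrC ler_pdivrMr//.
(* Under the square root only [\det A <= E ^+ 2 * \det B] is required; the bound with [E] is
   stronger because [E >= 1]. *)
apply: (le_trans dAB); rewrite ler_pM2r// (le_trans cE)// expr2 ler_peMl// ltW//.
all: by rewrite ?invr_ge0 ltW.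
Qed.

(** Young's inequality with weight [th] splits the residual at [beta] into the residual at [beta0]
    and the difference of the means. As [G] dominates [G0], passing to the precision of [G0] is free
    in the exponent; the upper bound on [G] enters only through the normalising constants. The
    weight stays free so that it can be matched to [t]. *)
Lemma lik_ratio_ge beta0 beta G0 G (tau zeta e t th : R) (y : sample D) :
  posdefmx G0 -> posdefmx G -> 0 <= tau -> 0 < th ->
  (forall i w, sqn ((random_design D i)^T *m w) <= zeta ^+ 2 * sqn w) ->
  (forall w, qf G0 w <= qf G w <= qf G0 w + tau * sqn w) ->
  (forall i j, `|reg_mean f D beta i j 0 - reg_mean f D beta0 i j 0| <= e) ->
  qf (precision sigma2 D G0) (col_of_tuple y - mean_vec f D beta0) <= t ->
  expR (- (N%:R * (zeta ^+ 2 * tau / sigma2) + th * t +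
           (1 + th^-1) * (N%:R * e ^+ 2 / sigma2)))
  <= lik_ratio f sigma2 beta0 G0 beta G y.
Proof.
move=> pG0 pG tau0 th0 Zz GG0 be Qt.
have p0 := @precision_posdef R p r n sigma2 D sigma2_gt0 G0 pG0.
have p1 := @precision_posdef R p r n sigma2 D sigma2_gt0 G pG.
have a0 : 0 <= zeta ^+ 2 * tau / sigma2.
  by apply: divr_ge0; [apply: mulr_ge0 => //; exact: sqr_ge0|exact: ltW].
rewrite lik_ratioE !pdfE//; set a := zeta ^+ 2 * tau / sigma2 in a0 *.
set A0 := precision _ _ G0 in p0 Qt *; set A := precision _ _ G in p1 *.
set u := col_of_tuple y - mean_vec f D beta0 in Qt *.
set v := col_of_tuple y - mean_vec f D beta.
have gc : gauss_const A0 <= expR (N%:R * a) * gauss_const A.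
  apply: gauss_const_le => // w; apply: qf_precision_scale => // w'.
  by have /andP[] := GG0 w'.
have c0 : 0 < gauss_const A0 by exact: gauss_const_gt0.
have Qv : qf A v <= qf A0 u + th * t + (1 + th^-1) * (N%:R * e ^+ 2 / sigma2).
  have -> : v = u + (mean_vec f D beta0 - mean_vec f D beta).
    by rewrite addrA subrK.
  apply: (le_trans (qf_precision_anti _ pG0 pG _)); first by move=> w; have /andP[] := GG0 w.
  apply: (le_trans (qf_young _ _ p0 th0)); rewrite mulrDl mul1r; apply: lerD.
    by rewrite lerD2l ler_pM2l.
  rewrite ler_pM2l ?ltr_pwDl ?invr_ge0 ?(ltW th0)//.
  apply: (le_trans (qf_precision_ub _ pG0)).
  by rewrite [leRHS]mulrC ler_pM2l ?invr_gt0//; exact: sqn_mean_vec.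
have Q0 : 0 <= th * t + (1 + th^-1) * (N%:R * e ^+ 2 / sigma2).
  apply: addr_ge0; apply: mulr_ge0.
  - exact: ltW.
  - by apply: le_trans Qt; exact: posdef_qf_ge0.
  - by rewrite addr_ge0// invr_ge0 ltW.
  - apply: divr_ge0; last exact: ltW.
    by apply: mulr_ge0 => //; exact: sqr_ge0.
rewrite ler_pdivlMr ?mulr_gt0 ?expR_gt0//.
rewrite mulrCA -expRD.
apply: (@le_trans _ _ (gauss_const A * expR (N%:R * a) *
    expR (- (N%:R * a + th * t + (1 + th^-1) * (N%:R * e ^+ 2 / sigma2)) +
      - qf A0 u / 2))).
  by rewrite ler_pM2r ?expR_gt0// mulrC.
rewrite -mulrA -expRD ler_pM2l; last exact: gauss_const_gt0.
rewrite ler_expR; exact: half_exponent_le Q0 Qv.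
Qed.

End likelihood_ratio.

(** Transfers a bound on [Z] to [Z^T], the matrix that acts in [qf_Delta]. It comes from expanding
    the squared norm of [z^2 w - Z Z^T w]. *)
Lemma sqn_trmx_le (R : realType) m n (Z : 'M[R]_(m, n)) (z : R) : 0 < z ->
  (forall v, sqn (Z *m v) <= z ^+ 2 * sqn v) ->
  forall w, sqn (Z^T *m w) <= z ^+ 2 * sqn w.
Proof.
move=> z0 Zz w; set u := Z^T *m w.
have := sqn_ge0 (z ^+ 2 *: w - Z *m u).
rewrite -[sqn (_ - _)]mul1r -qf_scalar qfD ?tr_scalar_mx// qfN qfZ !qf_scalar !mul1r.
have -> : ((z ^+ 2 *: w)^T *m 1%:M *m - (Z *m u)) 0 0 = - (z ^+ 2 * sqn u).
  rewrite mulmx1 mulmxN linearZ /= -scalemxAl mulmxA -[w^T *m Z]trmxK trmx_mul trmxK.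
  by rewrite -/u sqnE !mxE.
have := Zz u; set a := z ^+ 2 => Zu h.
have a0 : 0 < a by rewrite exprn_gt0.
by rewrite -(ler_pM2l a0); nra.
Qed.

(** * Euclidean norm and measurability of Lipschitz functions *)

Section norm2_theory.
Context {R : realType}.

Lemma norm2_le n (v : 'cV[R]_n) e : (forall k, `|v k 0| <= e) -> norm2 v <= n%:R * e.
Proof.
case: n v => [|n] v ve; first by rewrite /norm2 big_ord0 sqrtr0 mul0r.
have e0 : 0 <= e := le_trans (normr_ge0 _) (ve ord0).
rewrite /norm2 -[leRHS]ger0_norm ?mulr_ge0// -sqrtr_sqr ler_wsqrtr//.
apply: (@le_trans _ _ (n.+1%:R * e ^+ 2)).
  have -> : n.+1%:R * e ^+ 2 = \sum_(s < n.+1) e ^+ 2.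
    by rewrite sumr_const card_ord mulr_natl.
  by apply: ler_sum => k _; rewrite -real_normK ?num_real// ler_sqr ?nnegrE.
by rewrite exprMn ler_wpM2r ?sqr_ge0// expr2 ler_peMl// ler1n.
Qed.

Lemma norm2_ge_entry n (v : 'cV[R]_n) k : `|v k 0| <= norm2 v.
Proof.
rewrite /norm2 -sqrtr_sqr ler_wsqrtr// (bigD1 k)//= lerDl.
by apply: sumr_ge0 => j _; exact: sqr_ge0.
Qed.

Lemma measurable_sqrt : measurable_fun setT (@Num.sqrt R).
Proof. by apply: continuous_measurable_fun; exact: sqrt_continuous. Qed.

Lemma measurable_norm2 d (T : measurableType d) n (h : T -> 'cV[R]_n) :
  measurable_mx h -> measurable_fun setT (fun t => norm2 (h t)).
Proof.
move=> mh; apply: (measurableT_comp measurable_sqrt).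
by apply: measurable_sum => k; apply: measurable_funX; exact: mh.
Qed.

(* [g x = sup_v (g v - K |x - v|)] over rational [v] *)
Lemma measurable_lipschitz d (T : measurableType d) n (g : 'cV[R]_n -> R) K
    (h : T -> 'cV[R]_n) : 0 < K ->
  (forall x y, `|g x - g y| <= K * norm2 (x - y)) ->
  measurable_mx h -> measurable_fun setT (fun t => g (h t)).
Proof.
move=> K0 gK mh.
pose rv (v : 'cV[rat]_n) : 'cV[R]_n := map_mx ratr v.
have E a : [set t | a < g (h t)] = \bigcup_(i in [set: nat])
    [set t | oapp (fun v => a < g (rv v) - K * norm2 (h t - rv v)) false
               (unpickle i : option 'cV[rat]_n)].
  apply/seteqP; split => [t /= agt|t [i _] /=]; last first.
    case: (unpickle i) => //= v agv.
    apply: (lt_le_trans agv); rewrite lerBlDr -lerBlDl.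
    by apply: le_trans (gK _ _); rewrite distrC ler_norm.
  (* The distance to [v] is paid twice, by the Lipschitz bound and by the penalty, hence the 2;
     [n.+1] keeps the denominator positive and the final inequality strict. *)
  pose e := (g (h t) - a) / (2 * K * n.+1%:R).
  have e0 : 0 < e by rewrite divr_gt0 ?mulr_gt0 ?subr_gt0.
  have /choice[w hw] : forall k, exists x : rat, ratr x \in `](h t k 0 - e), (h t k 0 + e)[.
    by move=> k; apply: rat_in_itvoo; lra.
  pose v : 'cV[rat]_n := \col_k w k.
  have hv : norm2 (h t - rv v) <= n%:R * e.
    apply: norm2_le => k; rewrite !mxE ler_distlC.
    by have := hw k; rewrite in_itv/= => /andP[h1 h2]; rewrite !ltW.
  exists (pickle v) => //=; rewrite pickleK /=.
  have h1 : g (h t) - g (rv v) <= K * norm2 (h t - rv v).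
    by apply: le_trans (gK _ _); exact: ler_norm.
  have h2 : K * norm2 (h t - rv v) <= K * (n%:R * e) by rewrite ler_pM2l.
  have h3 : 2 * (K * (n%:R * e)) < g (h t) - a.
    have -> : 2 * (K * (n%:R * e)) = (g (h t) - a) * (n%:R / n.+1%:R).
      have m0 : n.+1%:R != 0 :> R by rewrite pnatr_eq0.
      by rewrite /e; move: (n.+1%:R : R) m0 => m m0; field; rewrite m0 gt_eqF.
    rewrite gtr_pMr ?subr_gt0// ltr_pdivrMr// mul1r ltr_nat//.
  lra.
move=> mT; apply: (measurability _ (RGenOInfty.measurableE R)) => //.
move=> _ [_ [a ->] <-]; rewrite setTI.
rewrite (_ : _ @^-1` _ = [set t | a < g (h t)]); last first.
  by apply/seteqP; split => t /=; rewrite in_itv/= andbT.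
rewrite E; apply: bigcup_measurable => i _.
case: (unpickle i) => [v|] /=; last first.
  by rewrite (_ : mkset _ = set0)//; apply/seteqP; split.
rewrite -[X in measurable X]setTI; apply: measurable_fun_ltr => //.
apply: measurable_funB => //; apply: measurable_funM => //; apply: measurable_norm2.
by apply: measurable_mx_add => //; exact: measurable_mx_cst.
Qed.

End norm2_theory.

(** * Measurability and Tonelli *)

Section measurability.
Context {R : realType}.

Lemma measurable_nth n k : measurable_fun setT (fun x : n.-tuple R => nth 0 x k).
Proof.
have [kn|kn] := ltnP k n.
  rewrite (_ : (fun _ => _) = (fun x : n.-tuple R => tnth x (Ordinal kn))).
    exact: measurable_tnth.
  by apply/funext => x; rewrite (tnth_nth 0).
rewrite (_ : (fun _ => _) = cst 0); first exact: measurable_cst.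
by apply/funext => x; rewrite nth_default// size_tuple.
Qed.

Lemma measurable_embed N (S : {set 'I_N}) :
  measurable_mx (fun x : #|S|.-tuple R => embed x).
Proof.
move=> i j; under eq_fun do rewrite mxE.
by have [_|_] := boolP (i \in S); [exact: measurable_nth|exact: measurable_cst].
Qed.

Lemma measurable_symmx r : measurable_mx (@symmx R r).
Proof. by move=> i j; under eq_fun do rewrite mxE; exact: measurable_nth. Qed.

Lemma tr_symmx r g : (@symmx R r g)^T = symmx g.
Proof. by apply/matrixP => i j; rewrite !mxE maxnC minnC. Qed.

Lemma measurable_posdef_cone r : measurable (@posdef_cone R r).
Proof.
by apply: measurable_posdef; [exact: measurable_symmx|exact: tr_symmx].
Qed.

Lemma measurable_mx_comp d d' (T : measurableType d) (U : measurableType d') m n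
  (F : U -> 'M[R]_(m, n)) (g : T -> U) : measurable_mx F ->
  measurable_fun setT g -> measurable_mx (fun t => F (g t)).
Proof. by move=> mF mg i j; exact: measurableT_comp (mF i j) mg. Qed.

Lemma measurable_iwishart_kernel d (T : measurableType d) r (a : R) (Sigma : 'M[R]_r)
    (G : T -> 'M[R]_r) : measurable_mx G ->
  measurable_fun setT (fun t => iwishart_kernel a Sigma (G t)).
Proof.
move=> mG; apply: measurable_funM.
  apply: (measurableT_comp (measurable_powR _)); exact: measurable_det.
apply: measurableT_comp => //; apply: measurableT_comp => //.
apply: measurable_funM => //; apply: measurable_sum => i.
apply: measurable_mx_mul; first exact: measurable_mx_cst.
exact: measurable_invmx.
Qed.

Lemma measurable_laplace_pdf (l : R) : measurable_fun setT (laplace_pdf l).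
Proof.
apply: measurable_funM => //; apply: measurableT_comp => //.
apply: measurableT_comp => //; exact: measurable_funM.
Qed.

Lemma measurable_laplace_prod n (l : R) :
  measurable_fun setT (fun x : n.-tuple R => \prod_(k < n) laplace_pdf l (tnth x k)).
Proof.
apply: measurable_prod => k _; apply: (measurableT_comp (measurable_laplace_pdf l)).
exact: measurable_tnth.
Qed.

(** Tonelli requires joint measurability in parameters and data. At each fixed time, the dependence
    on [f] is handled by its Lipschitz property in the first argument. *)
Lemma measurable_pdf d (T : measurableType d) q p r n (f : 'cV[R]_q -> R -> R)
    (sigma2 K : R) (D : design R p r n) (b : T -> 'cV[R]_(q * p)) (G : T -> 'M[R]_r)
    (Y : T -> sample D) : 0 < K ->
  (forall x y t, `|f x t - f y t| <= K * norm2 (x - y)) ->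
  measurable_mx b -> measurable_mx G -> measurable_fun setT Y ->
  measurable_fun setT (fun t => pdf f sigma2 (b t) (G t) (Y t)).
Proof.
move=> K0 fK mb mG mY; apply: measurable_prod => i _.
have mD : measurable_mx (fun t => Delta sigma2 D (G t) i).
  apply: measurable_mx_add; last exact: measurable_mx_cst.
  apply: measurable_mx_mul; last exact: measurable_mx_cst.
  by apply: measurable_mx_mul => //; exact: measurable_mx_cst.
apply: measurable_funM.
  apply: measurable_invr; apply: (measurableT_comp measurable_sqrt).
  by apply: measurable_funM => //; exact: measurable_det.
apply: measurableT_comp => //; apply: measurable_funM => //.
apply: measurableT_comp => //.
apply: measurable_qf; first exact: measurable_invmx.
apply: measurable_mx_add.
  move=> j k; under eq_fun do rewrite !mxE.
  exact: (measurableT_comp (measurable_tnth _) mY).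
apply: measurable_mx_opp => j k; under eq_fun do rewrite mxE.
apply: (@measurable_lipschitz R _ T q (fun x => f x (time j)) K) => //.
by apply: measurable_mx_mul => //; exact: measurable_mx_cst.
Qed.

End measurability.

Section integration.
Context {R : realType}.
Local Open Scope ereal_scope.

(* unlike [ge0_le_integral], no measurability is required *)
Lemma le_integral_ge0 d (T : measurableType d) (mu : {measure set T -> \bar R})
    (D : set T) (f g : T -> \bar R) :
  (forall x, D x -> 0 <= f x) -> (forall x, D x -> f x <= g x) ->
  \int[mu]_(x in D) f x <= \int[mu]_(x in D) g x.
Proof.
move=> f0 fg; rewrite !ge0_integralE//; last first.
  by move=> x Dx; apply: le_trans (fg x Dx); exact: f0.
apply: ereal_sup_le => _ /= [h hf <-]; exists h => // x.
apply: (le_trans (hf x)); rewrite !patchE; case: ifPn => // /set_mem; exact: fg.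
Qed.

Lemma integral_ge_box n (a : 'I_n -> R) (h c : R) (D : set (n.-tuple R))
    (F : n.-tuple R -> \bar R) : (0 <= h)%R -> (0 <= c)%R ->
  (forall x, D x -> 0 <= F x) -> box a h `<=` D -> (forall x, box a h x -> c%:E <= F x) ->
  (c * (2 * h) ^+ n)%:E <= \int[@leb R n]_(x in D) F x.
Proof.
move=> h0 c0 F0 bD cF.
apply: (@le_trans _ _ (\int[@leb R n]_(x in D) (c * \1_(box a h) x)%:E)).
  rewrite integral_mkcond (_ : (fun x => _) \_ D = fun x => (c * \1_(box a h) x)%:E).
    under eq_integral do rewrite EFinM.
    rewrite ge0_integralZl_EFin//; last first.
      by apply/measurable_EFinP; apply: measurable_indic; exact: measurable_box.
    have mb := measurable_box a h.
    by rewrite integral_indic// setIT [X in _ * X](leb_box a h0).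
  apply/funext => x; rewrite patchE; case: ifPn => // /negP xD.
  rewrite indicE memNset ?mulr0// => /bD /mem_set; exact: xD.
apply: le_integral_ge0 => x Dx; first by rewrite lee_fin mulr_ge0.
rewrite indicE; case: (boolP (x \in box a h)) => [/set_mem xb|_].
  by rewrite mulr1; exact: cF.
by rewrite mulr0; exact: F0.
Qed.

(** Two exchanges: [y] with [x], then [y] with [g] at fixed [x]. *)
Lemma tonelli3 d1 d2 d3 (X : measurableType d1) (G : measurableType d2)
    (Y : measurableType d3) (mx : {sigma_finite_measure set X -> \bar R})
    (mg : {sigma_finite_measure set G -> \bar R})
    (my : {sigma_finite_measure set Y -> \bar R}) (H : X -> G -> Y -> \bar R) :
  measurable_fun setT (fun z : X * G * Y => H z.1.1 z.1.2 z.2) ->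
  (forall x g y, 0 <= H x g y) ->
  measurable_fun setT (fun y => \int[mx]_x \int[mg]_g H x g y) /\
  \int[my]_y \int[mx]_x \int[mg]_g H x g y =
  \int[mx]_x \int[mg]_g \int[my]_y H x g y.
Proof.
move=> mH H0.
have mF : measurable_fun setT (fun z : X * Y => \int[mg]_g H z.1 g z.2).
  apply: (measurable_fun_fubini_tonelli_F (fun z : X * Y * G => H z.1.1 z.2 z.1.2)) => //.
  apply: (measurableT_comp (f := fun z : X * G * Y => H z.1.1 z.1.2 z.2)
    (g := fun z : X * Y * G => (z.1.1, z.2, z.1.2))) => //.
  apply: measurable_fun_pair; last exact: (measurableT_comp measurable_snd measurable_fst).
  by apply: measurable_fun_pair => //; exact: (measurableT_comp measurable_fst measurable_fst).
split.
  apply: (measurable_fun_fubini_tonelli_G (fun z : X * Y => \int[mg]_g H z.1 g z.2)) => // z.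
  exact: integral_ge0.
rewrite -(fubini_tonelli (fun z : X * Y => \int[mg]_g H z.1 g z.2))//; last first.
  by move=> z; exact: integral_ge0.
apply: eq_integral => x _; apply/esym.
apply: (fubini_tonelli (fun z : G * Y => H x z.1 z.2)) => //.
apply: (measurableT_comp (f := fun z : X * G * Y => H z.1.1 z.1.2 z.2)
    (g := fun z : G * Y => (x, z.1, z.2))) => //.
apply: measurable_fun_pair => //; exact: measurable_fun_pair.
Qed.

Lemma integral_laplace_pdf (l : R) : (0 < l)%R ->
  \int[lebesgue_measure]_x (laplace_pdf l x)%:E = 1.
Proof.
move=> l0.
have lp0 x : (0 <= laplace_pdf l x)%R by rewrite /laplace_pdf mulr_ge0 ?expR_ge0 ?divr_ge0// ltW.
rewrite ge0_symfun_integralT//; last 2 first.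
- move=> x; apply: cvgM; first exact: cvg_cst.
  apply: (cvg_comp _ expR); last exact: continuous_expR.
  apply: cvgN; apply: cvgM; first exact: cvg_cst.
  exact: norm_continuous.
- by move=> x; rewrite /laplace_pdf /= normrN.
rewrite (_ : [set x | _]%R = `[0%R, +oo[%classic); last first.
  by apply/seteqP; split => x /=; rewrite in_itv/= andbT.
rewrite -(integral_exponential_pdf l0).
rewrite -ge0_integralZl_EFin//; last 2 first.
- by move=> x _; rewrite lee_fin.
- by apply/measurable_EFinP; apply: measurable_funTS; exact: measurable_laplace_pdf.
rewrite integral_mkcond; apply: eq_integral => x _.
rewrite /exponential_pdf !patchE; case: ifPn => //; rewrite inE /= in_itv/= andbT => x0.
rewrite -EFinM /laplace_pdf ger0_norm// mulNr; congr EFin.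
by field.
Qed.

End integration.

(** * Prior mass of neighbourhoods *)

Section covariance_prior.
Context {R : realType}.

Lemma oppmxE m n (A : 'M[R]_(m, n)) i j : (- A) i j = - A i j.
Proof. by rewrite mxE. Qed.

Lemma qf_entry_le n (F : 'M[R]_n) h v : (forall i j, `|F i j| <= h) ->
  `|qf F v| <= n%:R * h * sqn v.
Proof.
move=> Fh; rewrite qfE.
apply: (@le_trans _ _ (\sum_(i < n) \sum_(j < n) h * ((v i 0 ^+ 2 + v j 0 ^+ 2) / 2))).
  apply: (le_trans (ler_norm_sum _ _ _)); apply: ler_sum => i _.
  apply: (le_trans (ler_norm_sum _ _ _)); apply: ler_sum => j _.
  rewrite !normrM mulrAC [leRHS]mulrC.
  have h0 : 0 <= h := le_trans (normr_ge0 _) (Fh i j).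
  apply: ler_pM => //.
  rewrite -(real_normK (num_real (v i 0))) -(real_normK (num_real (v j 0))).
  have := sqr_ge0 (`|v i 0| - `|v j 0|); rewrite sqrrB; lra.
under eq_bigr do rewrite -mulr_sumr -mulr_suml big_split /= sumr_const card_ord.
rewrite -mulr_sumr -mulr_suml big_split /= sumr_const card_ord -/(sqn v).
rewrite sumrMnl -/(sqn v) -!(mulr_natl (sqn v)) le_eqVlt; apply/orP; left; apply/eqP.
by move: (n%:R : R) (sqn v) => a b; field.
Qed.

(** Nonnegativity at the sum and the difference of two basis vectors bounds [2 |B i j|] by
    [B i i + B j j]. *)
Lemma psd_entry_le n (B : 'M[R]_n) c i j : B^T = B ->
  (forall v, 0 <= qf B v <= c * sqn v) -> `|B i j| <= c.
Proof.
move=> Bt Bc; have dE k l : ((delta_mx k 0 : 'cV_n)^T *m B *m (delta_mx l 0 : 'cV_n)) 0 0 = B k l.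
  by rewrite trmx_delta -rowE -colE !mxE.
have sd k : sqn (delta_mx k 0 : 'cV[R]_n) = 1.
  rewrite /sqn (bigD1 k)//= big1 ?addr0 ?mxE ?eqxx ?expr1n// => l lk.
  by rewrite mxE (negbTE lk) expr0n.
have d0 k : B k k <= c.
  by have := Bc (delta_mx k 0); rewrite /qf dE sd mulr1 => /andP[].
have /andP[+ _] := Bc (delta_mx i 0 + delta_mx j 0).
have /andP[+ _] := Bc (delta_mx i 0 - delta_mx j 0).
rewrite !qfD// qfN mulmxN oppmxE !dE /qf !dE ler_norml.
have := d0 i; have := d0 j => h1 h2 h3 h4.
by apply/andP; split; lra.
Qed.

(** Value of the inverse-Wishart kernel in the worst case for a spectrum in [lo, U]: the determinant
    is at most [U ^+ r] and the entries of the inverse are at most [lo^-1] in absolute value. *)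
Definition kernel_lb r (d : R) (Sigma : 'M[R]_r) (lo U : R) : R :=
  (U ^+ r) `^ (- ((d + r%:R + 1) / 2)) *
  expR (- ((\sum_i \sum_j `|Sigma i j|) / lo / 2)).

Lemma kernel_lb_gt0 r (d : R) (Sigma : 'M[R]_r) (lo U : R) : 0 < U ->
  0 < kernel_lb d Sigma lo U.
Proof. by move=> U0; rewrite mulr_gt0 ?expR_gt0// powR_gt0// exprn_gt0. Qed.

Lemma iwishart_kernel_ge r (d : R) (Sigma G : 'M[R]_r) (lo U : R) :
  0 <= d + r%:R + 1 -> 0 < lo -> 0 < U -> posdefmx G ->
  (forall v, lo * sqn v <= qf G v <= U * sqn v) ->
  kernel_lb d Sigma lo U <= iwishart_kernel d Sigma G.
Proof.
move=> a0 lo0 U0 pG GU; apply: ler_pM => //; rewrite ?powR_ge0 ?expR_ge0//.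
  rewrite !powRN lef_pV2 ?posrE ?powR_gt0 ?exprn_gt0 ?posdef_det_gt0//.
  apply: ge0_ler_powR; rewrite ?nnegrE ?divr_ge0 ?exprn_ge0 ?(ltW U0)//.
    exact/ltW/posdef_det_gt0.
  rewrite -det_scalar; apply: det_posdef_le => //; first exact: posdef_scalar.
  by move=> v; rewrite qf_scalar; have /andP[] := GU v.
rewrite ler_expR lerN2 ler_pM2r//.
have pV := posdef_invmx pG.
have ent i j : `|invmx G i j| <= lo^-1.
  apply: psd_entry_le => [|v]; first exact: pV.1.
  rewrite posdef_qf_ge0//=.
  have := @qf_invmx_le R _ lo%:M G v (posdef_scalar _ lo0) pG.
  rewrite invmx_scalar qf_scalar; apply => w.
  by rewrite qf_scalar; have /andP[] := GU w.
rewrite /mxtrace mulr_suml; apply: ler_sum => i _.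
rewrite mxE mulr_suml; apply: ler_sum => j _.
by apply: (le_trans (ler_norm _)); rewrite normrM ler_wpM2l.
Qed.

Definition sym_pos (i j : nat) : nat := 'C((maxn i j).+1, 2) + minn i j.

Lemma sym_pos_lt r (i j : 'I_r) : (sym_pos i j < 'C(r.+1, 2))%N.
Proof.
apply: (@leq_trans 'C((maxn i j).+2, 2)); last first.
  by rewrite leq_bin2l// ltnS gtn_max !ltn_ord.
by rewrite [X in (_ < X)%N]binS bin1 /sym_pos ltn_add2l ltnS; lia.
Qed.

(** Column [j] of the upper triangle fills the positions from 'C(j + 1, 2) up to, but excluding,
    'C(j + 2, 2). These intervals are disjoint, so the position determines the larger index, and
    then the smaller one. *)
Lemma sym_pos_inj i j i' j' : sym_pos i j = sym_pos i' j' ->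
  maxn i j = maxn i' j' /\ minn i j = minn i' j'.
Proof.
move=> e; suff M : maxn i j = maxn i' j' by move: e; rewrite /sym_pos M => /addnI.
have lt a b a' b' : (maxn a b < maxn a' b')%N -> (sym_pos a b < sym_pos a' b')%N.
  move=> h; apply: (@leq_trans 'C((maxn a b).+2, 2)).
    by rewrite [X in (_ < X)%N]binS bin1 /sym_pos ltn_add2l ltnS; lia.
  by apply: leq_trans (leq_addr _ _); rewrite leq_bin2l.
case: (ltngtP (maxn i j) (maxn i' j')) => // /lt; first by rewrite e ltnn.
by rewrite e ltnn.
Qed.

Lemma symmx_box r (A : 'M[R]_r) : A^T = A ->
  exists a : 'I_('C(r.+1, 2)) -> R, forall h g, box a h g ->
    forall i j, `|symmx g i j - A i j| <= h.
Proof.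
move=> At.
(* A right inverse of [sym_pos], determined up to a swap of the indices, harmless as [A] is
   symmetric. The default 0 is never read: only positions of the form [sym_pos i j] are queried. *)
exists (fun k : 'I_('C(r.+1, 2)) =>
  if [pick ij : 'I_r * 'I_r | sym_pos ij.1 ij.2 == k :> nat] is Some ij
                 then A ij.1 ij.2 else 0).
move=> h g gh i j; have := gh (Ordinal (sym_pos_lt i j)).
case: pickP => [[i' j'] /= /eqP /sym_pos_inj[e1 e2]|/(_ (i, j))]; last by rewrite eqxx.
rewrite (tnth_nth 0) /= mxE; suff -> : A i' j' = A i j by [].
have [[/val_inj -> /val_inj ->//]|[/val_inj -> /val_inj ->]] :
    (i' = i :> nat /\ j' = j :> nat) \/ (i' = j :> nat /\ j' = i :> nat) by lia.
by rewrite -[in LHS]At mxE.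
Qed.

Lemma prior_Gamma_ge r (d : R) (Sigma G0 : 'M[R]_r) (lo hi h c : R)
    (F : 'M[R]_r -> R) :
  0 <= d + r%:R + 1 -> 0 < lo -> 0 < hi -> posdefmx G0 ->
  (forall v, lo * sqn v <= qf G0 v <= hi * sqn v) ->
  0 < h -> h <= 1 -> 0 < iwishart_mass d Sigma -> 0 <= c ->
  (forall G, posdefmx G -> 0 <= F G) ->
  (forall G, posdefmx G ->
    (forall v, qf G0 v <= qf G v <= qf G0 v + 3 * r%:R * h * sqn v) -> c <= F G) ->
  ((kernel_lb d Sigma lo (hi + 3 * r%:R) / iwishart_mass d Sigma * c *
    (2 * h) ^+ 'C(r.+1, 2))%:E
   <= prior_Gamma_int d Sigma (fun G => (F G)%:E))%E.
Proof.
move=> a0 lo0 hi0 pG0 G0b h0 h1 m0 c0 F0 cF.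
(* the box is centred at [G0 + 2 r h I], so that all its elements dominate [G0] *)
have At : (G0 + (2 * r%:R * h)%:M)^T = G0 + (2 * r%:R * h)%:M.
  by rewrite linearD /= tr_scalar_mx pG0.1.
have [a ha] := symmx_box At.
have U0 : 0 < hi + 3 * r%:R by rewrite ltr_pwDl// mulr_ge0.
have k0 : 0 < kernel_lb d Sigma lo (hi + 3 * r%:R) by exact: kernel_lb_gt0.
(* The perturbation [E] has entries at most [h], so its form is at most [r h sqn v]; against the
   shift [2 r h] this leaves an excess between [r h] and [3 r h] times [sqn v]. *)
have G0G g : box a h g -> forall v,
    qf G0 v <= qf (symmx g) v <= qf G0 v + 3 * r%:R * h * sqn v.
  move=> /ha gh v; set E := symmx g - (G0 + (2 * r%:R * h)%:M).
  have Eh i j : `|E i j| <= h by have := gh i j; rewrite /E addmxE oppmxE.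
  have := qf_entry_le v Eh.
  have -> : symmx g = G0 + (2 * r%:R * h)%:M + E by rewrite addrC subrK.
  rewrite !qf_addmx qf_scalar ler_norml => /andP[e1 e2].
  have r0 : 0 <= r%:R * h * sqn v by rewrite !mulr_ge0 ?sqn_ge0// ltW.
  by apply/andP; split; lra.
have pg g : box a h g -> posdefmx (symmx g).
  move=> gb; apply: (posdef_ge pG0); first exact: tr_symmx.
  by move=> v; have /andP[] := G0G g gb v.
apply: (@integral_ge_box R _ a h) => //; first exact: ltW.
- by rewrite mulr_ge0// divr_ge0// ltW.
- move=> g cg; rewrite -EFinM lee_fin mulr_ge0 ?F0// divr_ge0 ?(ltW m0)//.
  by rewrite mulr_ge0 ?powR_ge0 ?expR_ge0.
- move=> g gb; rewrite -EFinM lee_fin; apply: ler_pM => //.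
  + by rewrite divr_ge0// ltW.
  + rewrite ler_pM2r ?invr_gt0//; apply: iwishart_kernel_ge => //; first exact: pg.
    move=> v; have /andP[b1 b2] := G0G g gb v; have /andP[b3 b4] := G0b v.
    apply/andP; split; first exact: le_trans b3 b1.
    apply: (le_trans b2); rewrite (mulrDl hi); apply: lerD => //.
    by rewrite ler_wpM2r ?sqn_ge0// ler_piMr// mulr_ge0.
  + by apply: cF; [exact: pg|exact: G0G].
Qed.

End covariance_prior.

Section regression_prior.
Context {R : realType}.

(** Only the summand [S = supp b0] is kept. On the box each Laplace factor is at least [lambda / 2 *
    expR (- (lambda * (B + eta)))], and the side [2 * eta] of the box cancels the 1/2. *)
Lemma prior_beta_ge N (pmf : nat -> R) (lambda eta B c : R) (b0 : 'cV[R]_N)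
    (H : 'cV[R]_N -> \bar R) :
  (forall s, (s <= N)%N -> 0 <= pmf s) -> 0 < lambda -> 0 < eta ->
  (forall l, `|b0 l 0| <= B) -> 0 <= c -> (forall b, 0 <= H b)%E ->
  (forall b : 'cV[R]_N, (forall l, `|b l 0 - b0 l 0| <= eta) ->
    (forall l, l \notin supp b0 -> b l 0 = 0) -> (c%:E <= H b)%E) ->
  ((pmf #|supp b0| / 'C(N, #|supp b0|)%:R *
    ((lambda * eta * expR (- (lambda * (B + eta)))) ^+ #|supp b0| * c))%:E
   <= prior_beta_int pmf lambda H)%E.
Proof.
move=> pmf0 l0 e0 b0B c0 H0 cH.
set S := supp b0.
have w0 (T : {set 'I_N}) : 0 <= pmf #|T| / 'C(N, #|T|)%:R.
  by rewrite divr_ge0// pmf0// -[leqRHS]card_ord max_card.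
have lp0 x : 0 <= laplace_pdf lambda x.
  by rewrite mulr_ge0 ?expR_ge0// divr_ge0// ltW.
have I0 (T : {set 'I_N}) : (0 <= \int[lebesgue_tuple #|T|]_x
   ((\prod_(k < #|T|) laplace_pdf lambda (tnth x k))%R%:E * H (embed x)))%E.
  by apply: integral_ge0 => x _; rewrite mule_ge0// lee_fin prodr_ge0.
rewrite /prior_beta_int (bigD1 S)//=.
apply: (@le_trans _ _ ((pmf #|S| / 'C(N, #|S|)%:R)%:E * \int[lebesgue_tuple #|S|]_x
   ((\prod_(k < #|S|) laplace_pdf lambda (tnth x k))%R%:E * H (embed x)))%E); last first.
  rewrite leeDl// sume_ge0// => T _; rewrite mule_ge0// lee_fin; exact: w0.
rewrite EFinM; apply: lee_wpmul2l; first by rewrite lee_fin; exact: w0.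
have -> : (lambda * eta * expR (- (lambda * (B + eta)))) ^+ #|S| * c =
   (lambda / 2 * expR (- (lambda * (B + eta)))) ^+ #|S| * c * (2 * eta) ^+ #|S|.
  by rewrite [RHS]mulrAC -exprMn; congr (_ ^+ _ * _); field.
pose a (k : 'I_#|S|) := b0 (enum_val k) 0.
apply: (@integral_ge_box R _ a eta) => //; first exact: ltW.
- by rewrite mulr_ge0 ?exprn_ge0// mulr_ge0 ?expR_ge0// divr_ge0// ltW.
- by move=> x _; rewrite mule_ge0// lee_fin prodr_ge0.
- move=> x xa; rewrite EFinM; apply: lee_pmul; rewrite ?lee_fin//.
  + by rewrite exprn_ge0// mulr_ge0 ?expR_ge0// divr_ge0// ltW.
  + rewrite -[X in _ ^+ X]card_ord -prodr_const; apply: ler_prod => k _.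
    rewrite mulr_ge0 ?expR_ge0 ?divr_ge0 ?(ltW l0)//=.
    rewrite ler_pM2l ?divr_gt0// ler_expR lerN2 ler_pM2l//.
    rewrite -[tnth x k](subrK (a k)) addrC (le_trans (ler_normD _ _))// lerD//.
    exact: b0B.
  + apply: cH => l; last by move=> lS; rewrite mxE (negbTE lS).
    rewrite mxE; case: ifPn => [lS|]; last first.
      by rewrite inE negbK => /eqP ->; rewrite subrr normr0 ltW.
    have il : (index l (enum S) < #|S|)%N by rewrite cardE index_mem mem_enum.
    have := xa (Ordinal il); rewrite (tnth_nth 0) /a /=.
    by rewrite (enum_val_nth l) /= nth_index ?mem_enum.
Qed.

End regression_prior.

(** * Posterior mass of large supports *)

Section posterior_bound.
Context {R : realType} {q p r n : nat}.
Variables (f : 'cV[R]_q -> R -> R) (sigma2 K : R) (D : design R p r n).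
Variables (pmf : nat -> R) (lambda d : R) (Sigma : 'M[R]_r).
Variables (beta0 : 'cV[R]_(q * p)) (G0 : 'M[R]_r) (C1 : R).
Hypothesis sigma2_gt0 : 0 < sigma2.
Hypothesis K_gt0 : 0 < K.
Hypothesis f_lip : forall x y t, `|f x t - f y t| <= K * norm2 (x - y).
Hypothesis pmf_ge0 : forall s, (s <= q * p)%N -> 0 <= pmf s.
Hypothesis lambda_gt0 : 0 < lambda.
Hypothesis G0_posdef : posdefmx G0.
Hypothesis mass_gt0 : 0 < iwishart_mass d Sigma.

Let M := (\sum_(i < n) nobs D i)%N.
Let s0 := #|supp beta0|.
Let B : set ('cV[R]_(q * p) * 'M[R]_r) :=
  [set bG | C1 * s0%:R < #|supp bG.1|%:R].
Let P0 (y : sample D) := pdf f sigma2 beta0 G0 y.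
Let L (y : sample D) (z : 'cV[R]_(q * p) * 'M[R]_r) :=
  lik_ratio f sigma2 beta0 G0 z.1 z.2 y.
Let num y := prior_int pmf lambda d Sigma (fun z => (\1_B z * L y z)%:E).
Let den y := prior_int pmf lambda d Sigma (fun z => (L y z)%:E).
Let w (S : {set 'I_(q * p)}) := pmf #|S| / 'C(q * p, #|S|)%:R.
Let big (S : {set 'I_(q * p)}) := C1 * s0%:R < #|S|%:R.
Let lap (S : {set 'I_(q * p)}) (x : #|S|.-tuple R) :=
  \prod_(k < #|S|) laplace_pdf lambda (tnth x k).
Let kap (g : 'C(r.+1, 2).-tuple R) :=
  iwishart_kernel d Sigma (symmx g) / iwishart_mass d Sigma.
(** The prior density of Gamma extended by 0 off the cone, so that Tonelli applies on the whole
    space. *)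
Let kapc g := if g \in @posdef_cone R r then kap g else 0.
(** Joint density of the coordinates in [S], the covariance and the data, given the support [S]. *)
Let H (S : {set 'I_(q * p)}) (x : #|S|.-tuple R) g (y : sample D) : R :=
  lap x * (kapc g * pdf f sigma2 (embed x) (symmx g) y).
(** Prior predictive density of the data given the support [S]. *)
Let IH (S : {set 'I_(q * p)}) (y : sample D) :=
  (\int[@leb R _]_x \int[@leb R _]_g (@H S x g y)%:E)%E.

Let w_ge0 S : 0 <= w S.
Proof. by rewrite divr_ge0// pmf_ge0// -[leqRHS]card_ord max_card. Qed.

Let lap_ge0 (S : {set 'I_(q * p)}) (x : #|S|.-tuple R) : 0 <= lap x.
Proof.
by apply: prodr_ge0 => k _; rewrite mulr_ge0 ?expR_ge0// divr_ge0// ltW.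
Qed.

Let kap_ge0 g : 0 <= kap g.
Proof. by rewrite divr_ge0 ?(ltW mass_gt0)// mulr_ge0 ?powR_ge0 ?expR_ge0. Qed.

Let kapc_ge0 g : 0 <= kapc g.
Proof. by rewrite /kapc; case: ifP. Qed.

Let P0_gt0 y : 0 < P0 y.
Proof. exact: pdf_gt0. Qed.

Let kapc_pdf_ge0 b g y : 0 <= kapc g * pdf f sigma2 (D := D) b (symmx g) y.
Proof.
rewrite /kapc; case: ifPn => [/set_mem pg|_]; last by rewrite mul0r.
by rewrite mulr_ge0// ltW// pdf_gt0.
Qed.

Let H_ge0 (S : {set 'I_(q * p)}) x g y : 0 <= @H S x g y.
Proof. by rewrite mulr_ge0. Qed.

Let measurable_kapc : measurable_fun setT kapc.
Proof.
apply: measurable_fun_ifT => //.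
  apply: (measurable_fun_bool true); rewrite setTI.
  rewrite (_ : _ @^-1` _ = @posdef_cone R r); first exact: measurable_posdef_cone.
  by apply/seteqP; split => g /=; [move/set_mem|move/mem_set].
apply: measurable_funM => //; apply: measurable_iwishart_kernel.
exact: measurable_symmx.
Qed.

Let measurable_kapc_pdf d' (T : measurableType d') (b : T -> 'cV[R]_(q * p))
    (g : T -> 'C(r.+1, 2).-tuple R) (y : T -> sample D) :
  measurable_mx b -> measurable_fun setT g -> measurable_fun setT y ->
  measurable_fun setT (fun t => kapc (g t) * pdf f sigma2 (b t) (symmx (g t)) (y t)).
Proof.
move=> mb mg my; apply: measurable_funM; first exact: measurableT_comp.
apply: (@measurable_pdf R _ T q p r n f sigma2 K D b (fun t => symmx (g t)) y) => //.
by apply: measurable_mx_comp => //; exact: measurable_symmx.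
Qed.

Let measurable_H (S : {set 'I_(q * p)}) :
  measurable_fun setT (fun z : #|S|.-tuple R * 'C(r.+1, 2).-tuple R * sample D =>
    (@H S z.1.1 z.1.2 z.2)%:E).
Proof.
apply/measurable_EFinP; apply: measurable_funM.
  apply: (measurableT_comp (f := @lap S)); first exact: measurable_laplace_prod.
  exact: (measurableT_comp measurable_fst measurable_fst).
apply: measurable_kapc_pdf => //.
  apply: measurable_mx_comp; first exact: measurable_embed.
  exact: (measurableT_comp measurable_fst measurable_fst).
exact: (measurableT_comp measurable_snd measurable_fst).
Qed.

Let integral_kapc : (\int[@leb R _]_g (kapc g)%:E = 1)%E.
Proof.
have -> : (fun g => (kapc g)%:E) = (fun g => (kap g)%:E) \_ (@posdef_cone R r).
  by apply/funext => g; rewrite patchE /kapc; case: ifP.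
rewrite -integral_mkcond.
have fin : (\int[@leb R _]_(g in @posdef_cone R r) (iwishart_kernel d Sigma (symmx g))%:E)%E
    = (iwishart_mass d Sigma)%:E.
  (* [fine] sends infinite values to 0, so a positive mass makes the integral finite. *)
  rewrite /iwishart_mass fineK//.
  move: mass_gt0; rewrite /iwishart_mass.
  by case: (X in fine X) => //=; rewrite ltxx.
under eq_integral do rewrite /kap mulrC EFinM.
rewrite ge0_integralZl_EFin ?fin//.
- by rewrite -EFinM mulVf// gt_eqF.
- exact: measurable_posdef_cone.
- by move=> g _; rewrite lee_fin mulr_ge0 ?powR_ge0 ?expR_ge0.
- apply/measurable_EFinP; apply: measurable_funTS.
  by apply: measurable_iwishart_kernel; exact: measurable_symmx.
- by rewrite invr_ge0 ltW.
Qed.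

Let integral_IH (S : {set 'I_(q * p)}) :
  measurable_fun setT (@IH S) /\ (\int[@leb R _]_y IH S y = 1)%E.
Proof.
have [mI eI] := @tonelli3 R _ _ _ _ _ _ (@leb R #|S|) (@leb R _) (@leb R M)
  (fun x g y => (@H S x g y)%:E) (@measurable_H S) (fun x g y => H_ge0 x g y).
split => //; rewrite [LHS]eI.
transitivity (\int[@leb R #|S|]_x (lap x)%:E)%E; last first.
  apply: integral_leb_prod; first exact: measurable_laplace_pdf.
    by move=> x; rewrite mulr_ge0 ?expR_ge0// divr_ge0// ltW.
  exact: integral_laplace_pdf.
apply: eq_integral => x _; rewrite -[RHS]mule1 -integral_kapc.
rewrite -ge0_integralZl_EFin//; last 2 first.
- by move=> g _; rewrite lee_fin.
- exact/measurable_EFinP.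
apply: eq_integral => g _; rewrite /H.
under eq_integral do rewrite mulrA EFinM.
rewrite /kapc; case: ifPn => [/set_mem pg|_]; last first.
  by under eq_integral do rewrite mulr0 mul0e; rewrite integral0 mule0.
rewrite ge0_integralZl_EFin//; last 3 first.
- by move=> y _; rewrite lee_fin ltW// pdf_gt0.
- apply/measurable_EFinP.
  apply: (@measurable_pdf R _ (sample D) q p r n f sigma2 K D (fun=> embed x)
    (fun=> symmx g) id) => //.
- by rewrite mulr_ge0.
by rewrite integral_pdf// mule1 EFinM.
Qed.

(** The support of [embed x] lies in [S], possibly strictly, so a set [S] that is not [big]
    contributes 0; for the others the indicator is bounded by 1. *)
Let num_le y : (num y <= ((P0 y)^-1)%:E * \sum_(S | big S) (w S)%:E * IH S y)%E.
Proof.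
have P0V : 0 <= (P0 y)^-1 by rewrite invr_ge0 ltW.
have IH0 S : (0 <= IH S y)%E.
  by apply: integral_ge0 => x _; apply: integral_ge0 => g _; rewrite lee_fin.
rewrite ge0_sume_distrr; last by move=> S _; rewrite mule_ge0// lee_fin w_ge0.
rewrite [leRHS]big_mkcond; apply: lee_sum => S _; rewrite -/(w S).
case: ifPn => [bS|bS]; last first.
  rewrite integral0_eq ?mule0// => x _.
  rewrite /prior_Gamma_int integral0_eq ?mule0// => g _.
  rewrite indicE memNset ?mul0r ?mule0//= => h.
  have sS : (#|supp (embed x)| <= #|S|)%N.
    apply: subset_leq_card; apply/fintype.subsetP => l; rewrite inE mxE.
    by case: ifP => //; rewrite eqxx.
  move: bS; rewrite /big -leNgt => /le_lt_trans /(_ h).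
  by rewrite ltr_nat ltnNge sS.
rewrite muleCA; apply: lee_wpmul2l; first by rewrite lee_fin.
rewrite -ge0_integralZl_EFin//; last 2 first.
- by move=> x _; apply: integral_ge0 => g _; rewrite lee_fin.
- apply: (measurable_fun_fubini_tonelli_F (m2 := @leb R _)
    (fun z : #|S|.-tuple R * 'C(r.+1, 2).-tuple R => (@H S z.1 z.2 y)%:E)) => [|z].
    apply: (measurableT_comp (@measurable_H S)
       (g := fun z : #|S|.-tuple R * 'C(r.+1, 2).-tuple R => (z.1, z.2, y))).
    by apply: measurable_fun_pair => //; exact: measurable_fun_pair.
  by rewrite lee_fin.
apply: le_integral_ge0 => x _; rewrite /prior_Gamma_int.
  rewrite mule_ge0 ?lee_fin ?lap_ge0//; apply: integral_ge0 => g cg.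
  rewrite -EFinM lee_fin mulr_ge0 ?kap_ge0// mulr_ge0// /L lik_ratioE.
  by rewrite divr_ge0// ltW ?pdf_gt0.
under [X in (_ <= _ * X)%E]eq_integral do rewrite /H EFinM.
rewrite ge0_integralZl_EFin//; last 2 first.
- by move=> g _; rewrite lee_fin.
- apply/measurable_EFinP; apply: measurable_kapc_pdf => //; exact: measurable_mx_cst.
rewrite [leRHS]muleCA; apply: lee_wpmul2l; first by rewrite lee_fin; exact: lap_ge0.
rewrite -ge0_integralZl_EFin//; last 2 first.
- by move=> g _; rewrite lee_fin.
- apply/measurable_EFinP; apply: measurable_kapc_pdf => //; exact: measurable_mx_cst.
rewrite [leLHS]integral_mkcond; apply: (@le_integral_ge0 _ _ _ (@leb R _) setT) => g _;
  rewrite patchE /kapc.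
  case: ifPn => // /set_mem pg; rewrite -EFinM lee_fin.
  apply: mulr_ge0; first exact: kap_ge0.
  by apply: mulr_ge0 => //; rewrite /L lik_ratioE divr_ge0// ltW ?pdf_gt0.
case: ifPn => [/set_mem pg|_]; last by rewrite mul0r mule0.
rewrite -!EFinM lee_fin [leRHS]mulrCA; apply: ler_wpM2l; first exact: kap_ge0.
rewrite [leRHS](_ : _ = L y (embed x, symmx g)); last by rewrite /L lik_ratioE mulrC.
by rewrite ler_piMl// /L lik_ratioE divr_ge0// ltW ?pdf_gt0.
Qed.

Let num_ge0 y : (0 <= num y)%E.
Proof.
apply: sume_ge0 => S _; rewrite mule_ge0 ?lee_fin ?w_ge0//.
apply: integral_ge0 => x _; rewrite mule_ge0 ?lee_fin ?lap_ge0//.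
rewrite /prior_Gamma_int; apply: integral_ge0 => g pg; rewrite -EFinM lee_fin mulr_ge0 ?kap_ge0//.
by rewrite mulr_ge0// /L lik_ratioE divr_ge0// ltW ?pdf_gt0.
Qed.

Let num_le_den y : (num y <= den y)%E.
Proof.
apply: lee_sum => S _; apply: lee_wpmul2l; first by rewrite lee_fin w_ge0.
have L0 x g : @posdef_cone R r g -> 0 <= L y (@embed R _ S x, symmx g).
  by move=> pg; rewrite /L lik_ratioE divr_ge0// ltW ?pdf_gt0.
apply: le_integral_ge0 => x _.
  rewrite mule_ge0 ?lee_fin ?lap_ge0//; apply: integral_ge0 => g pg.
  by rewrite -EFinM lee_fin mulr_ge0 ?kap_ge0// mulr_ge0// L0.
apply: lee_wpmul2l; first by rewrite lee_fin lap_ge0.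
apply: le_integral_ge0 => g pg.
  by rewrite -EFinM lee_fin mulr_ge0 ?kap_ge0// mulr_ge0// L0.
rewrite lee_wpmul2l ?lee_fin ?kap_ge0// ler_piMl ?L0// indicE.
Qed.

Let posteriorE (y : sample D) :
  posterior f sigma2 pmf lambda d Sigma beta0 G0 y B = (num y / den y)%E.
Proof. by []. Qed.

Let posterior_le1 (y : sample D) :
  (posterior f sigma2 pmf lambda d Sigma beta0 G0 y B <= 1)%E.
Proof.
rewrite posteriorE; have := num_le_den y; have := num_ge0 y.
(* If [den y] is 0 then so is [num y], and 0 times the inverse of 0 is 0; if [den y] is infinite its
   inverse is 0. *)
move: (num y) (den y) => [a| |] [b| |] //=; rewrite ?lee_fin.
- move=> a0 ab; rewrite inver; case: eqVneq => [b0|b0].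
    have -> : a = 0 by apply/le_anti; rewrite a0 -b0 ab.
    by rewrite mul0e.
  rewrite -EFinM lee_fin ler_pdivrMr ?mul1r// lt_neqAle eq_sym b0/=.
  exact: le_trans ab.
- by move=> *; rewrite mulr0.
- by move=> *; rewrite invey mule0.
Qed.

Let posterior_le delta (y : sample D) : 0 < delta -> (delta%:E <= den y)%E ->
  (posterior f sigma2 pmf lambda d Sigma beta0 G0 y B <= (delta^-1)%:E * num y)%E.
Proof.
move=> d0; rewrite posteriorE muleC; have := num_ge0 y.
move: (num y) (den y) => a [b| |] //= a0; last first.
  by move=> _; rewrite invey mul0e mule_ge0// lee_fin invr_ge0 ltW.
rewrite lee_fin => db; have b0 : 0 < b by exact: lt_le_trans db.
rewrite inver gt_eqF//; apply: lee_wpmul2r => //.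
by rewrite lee_fin lef_pV2.
Qed.

Lemma expectation_posterior_le delta t : 0 < delta ->
  (forall y : sample D, qf (precision sigma2 D G0) (col_of_tuple y - mean_vec f D beta0) <= t ->
    (delta%:E <= den y)%E) ->
  (expectation f sigma2 beta0 G0 (fun y : sample D =>
     posterior f sigma2 pmf lambda d Sigma beta0 G0 y B)
   <= (Num.sqrt 2 ^+ M * expR (- (t / 4)) + delta^-1 * \sum_(S | big S) w S)%:E)%E.
Proof.
move=> d0 hden.
have pP := @precision_posdef R p r n sigma2 D sigma2_gt0 G0 G0_posdef.
have IH0 S y : (0 <= IH S y)%E.
  by apply: integral_ge0 => x _; apply: integral_ge0 => g _; rewrite lee_fin.
have mIH S : measurable_fun setT (@IH S) := (integral_IH S).1.
have m2 : measurable_fun setT (fun y => \sum_(S | big S) (w S)%:E * IH S y)%E.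
  apply: (eq_measurable_fun (fun y =>
    \sum_(S <- [seq S <- index_enum _ | big S]) (w S)%:E * IH S y)%E).
    by move=> y _; rewrite big_filter.
  apply: emeasurable_sum => S; exact: measurable_funeM.
apply: (@le_trans _ _ (\int[@leb R M]_y (
    (if (t < qf (precision sigma2 D G0) (col_of_tuple y - mean_vec f D beta0))%R
     then gauss_const (precision sigma2 D G0) *
       expR (- qf (precision sigma2 D G0) (col_of_tuple y - mean_vec f D beta0) / 2) else 0)%:E
    + (delta^-1)%:E * \sum_(S | big S) (w S)%:E * IH S y))%E).
  have sum0 y : (0 <= \sum_(S | big S) (w S)%:E * IH S y)%E.
    by apply: sume_ge0 => S _; rewrite mule_ge0// lee_fin w_ge0.
  (* Only the majorant is known to be measurable; the comparison is between suprema over simple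
     functions. *)
  apply: le_integral_ge0 => y _.
    rewrite mule_ge0// ?lee_fin ?(ltW (P0_gt0 y))// posteriorE mule_ge0//.
    by rewrite inve_ge0 (le_trans _ (num_le_den y)).
  rewrite -pdfE//; case: ltP => [_|yt].
    rewrite -[leLHS]adde0; apply: leeD; last by rewrite mule_ge0// lee_fin invr_ge0 ltW.
    rewrite -[leRHS]mule1; apply: lee_wpmul2l; first by rewrite lee_fin ltW.
    exact: posterior_le1.
  rewrite add0e; apply: (@le_trans _ _ ((P0 y)%:E * ((delta^-1)%:E * num y))%E).
    by apply: lee_wpmul2l; [rewrite lee_fin ltW|exact: posterior_le (hden y yt)].
  rewrite muleCA; apply: lee_wpmul2l; first by rewrite lee_fin invr_ge0 ltW.
  apply: (@le_trans _ _ ((P0 y)%:E * (((P0 y)^-1)%:E *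
      \sum_(S | big S) (w S)%:E * IH S y))%E).
    by apply: lee_wpmul2l; [rewrite lee_fin ltW|exact: num_le].
  by rewrite muleA -EFinM mulfV ?mul1e// gt_eqF.
rewrite ge0_integralD//; last 4 first.
- by move=> y _; rewrite lee_fin; case: ifP => // _; rewrite -pdfE// ltW.
- exact: measurable_gauss_tail.
- move=> y _; apply: mule_ge0; first by rewrite lee_fin invr_ge0 ltW.
  by apply: sume_ge0 => S _; rewrite mule_ge0// lee_fin w_ge0.
- exact: measurable_funeM.
rewrite EFinD; apply: leeD; first exact: gauss_tail.
rewrite ge0_integralZl_EFin//; last 2 first.
- by move=> y _; apply: sume_ge0 => S _; rewrite mule_ge0// lee_fin w_ge0.
- by rewrite invr_ge0 ltW.
rewrite EFinM; apply: lee_wpmul2l; first by rewrite lee_fin invr_ge0 ltW.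
under eq_integral do rewrite -big_filter.
rewrite ge0_integral_sum//; last 2 first.
- by move=> S; exact: measurable_funeM.
- by move=> S y _; rewrite mule_ge0// lee_fin w_ge0.
rewrite big_filter -sumEFin; apply: lee_sum => S _.
rewrite ge0_integralZl_EFin ?w_ge0//.
by have [_ ->] := integral_IH S; rewrite mule1.
Qed.

End posterior_bound.

(** * Counting supports, perturbing the means, and the prior on the dimension *)

Lemma bin_le_expn n m : ('C(n, m) <= n ^ m)%N.
Proof.
elim: m n => [|m IH] [|n]; rewrite ?bin0 ?expn0//.
apply: (@leq_trans (m.+1 * 'C(n.+1, m.+1))); first by rewrite leq_pmull.
rewrite -mul_bin_diag expnS leq_pmul2l//; apply: leq_trans (IH n) _.
by case: (m) => [|k]; rewrite ?expn0// leq_exp2r.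
Qed.

(** There are 'C(N, s) supports of size [s], which cancels the uniform weight. *)
Lemma sum_set_card (R : realType) (N : nat) (P : pred nat) (F : nat -> R) :
  \sum_(S : {set 'I_N} | P #|S|) F #|S| / 'C(N, #|S|)%:R =
  \sum_(s < N.+1 | P s) F s.
Proof.
have cN (S : {set 'I_N}) : (#|S| < N.+1)%N by rewrite ltnS -[leqRHS]card_ord max_card.
rewrite (partition_big (fun S : {set 'I_N} => Ordinal (cN S)) (fun s => P s))//=.
apply: eq_bigr => s Ps.
transitivity (\sum_(S in [set S : {set 'I_N} | #|S| == s :> nat]%SET) F s / 'C(N, s)%:R).
  rewrite big_mkcond [RHS]big_mkcond; apply: eq_bigr => S _; rewrite inE.
  rewrite -val_eqE /=; case: eqVneq => [->|]; last by rewrite andbF.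
  by rewrite Ps.
rewrite sumr_const card_draws card_ord -[LHS]mulr_natl mulrCA mulfV ?mulr1//.
by rewrite pnatr_eq0 -lt0n bin_gt0 -ltnS.
Qed.

Section design_bounds.
Context {R : realType} {q p r n : nat}.
Variables (f : 'cV[R]_q -> R -> R) (K : R) (D : design R p r n).
Hypothesis K_gt0 : 0 < K.
Hypothesis f_lip : forall x y t, `|f x t - f y t| <= K * norm2 (x - y).

Lemma Xi_entry_le i k l : `|Xi (q := q) D i k l| <= norm_col (Xmx (q := q) D).
Proof.
apply: (@le_trans _ _ (norm2 (col l (Xmx (q := q) D)))); last first.
  exact: (le_bigmax _ (fun j => norm2 (col j (Xmx (q := q) D)))).
have := norm2_ge_entry (col l (Xmx (q := q) D)) (tagnat.Rank i k).
rewrite mxE; suff -> : Xmx (q := q) D (tagnat.Rank i k) l = Xi D i k l by [].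
by have := mxcolK (fun i => Xi (q := q) D i) i => /matrixP/(_ k l); rewrite mxE.
Qed.

(** Both vectors vanish off [supp beta0], so each coordinate of the difference of linear predictors
    has at most [#|supp beta0|] nonzero terms. *)
Lemma reg_mean_dist (beta beta0 : 'cV[R]_(q * p)) eta i j :
  (forall l, `|beta l 0 - beta0 l 0| <= eta) ->
  (forall l, l \notin supp beta0 -> beta l 0 = 0) ->
  `|reg_mean f D beta i j 0 - reg_mean f D beta0 i j 0| <=
  K * (q%:R * (norm_col (Xmx (q := q) D) * (#|supp beta0|%:R * eta))).
Proof.
move=> be b0; rewrite !mxE; apply: (le_trans (f_lip _ _ _)); rewrite ler_pM2l//.
rewrite -mulmxBr; apply: norm2_le => k; rewrite mxE.
apply: (le_trans (ler_norm_sum _ _ _)).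
have -> : norm_col (Xmx (q := q) D) * (#|supp beta0|%:R * eta) =
    \sum_l norm_col (Xmx (q := q) D) * (if l \in supp beta0 then eta else 0).
  by rewrite -mulr_sumr; congr (_ * _); rewrite -[RHS]big_mkcond /= sumr_const mulr_natl.
apply: ler_sum => l _; rewrite normrM; apply: ler_pM => //; first exact: Xi_entry_le.
rewrite !mxE; case: ifPn => [_|lS]; first exact: be.
by rewrite b0// add0r normrN; move: lS; rewrite inE negbK => /eqP ->; rewrite normr0.
Qed.

End design_bounds.

Section dimension_prior.
Context {R : realType}.
Variables (N : nat) (pmf : nat -> R).

(** Were [pmf 0] zero, the upper ratio bound would propagate it to all sizes and the total mass
    would vanish; from a positive [pmf 0] the lower ratio bound propagates positivity. *)
Lemma pmf_pos (a b : R) : 0 < a -> 0 < b ->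
  (forall s, (s <= N)%N -> 0 <= pmf s) -> \sum_(s < N.+1) pmf s = 1 ->
  (forall s, (0 < s <= N)%N -> a * pmf s.-1 <= pmf s /\ pmf s <= b * pmf s.-1) ->
  forall s, (s <= N)%N -> 0 < pmf s.
Proof.
move=> a0 b0 pge0 psum pab.
have p00 : 0 < pmf 0.
  rewrite lt_neqAle pge0// andbT; apply/eqP => z.
  have z0 s : (s <= N)%N -> pmf s = 0.
    elim: s => [|s IH] sN; first by rewrite -z.
    have [_] := pab s.+1 sN; rewrite /= IH ?mulr0; last exact: ltnW.
    by move=> h; apply/le_anti; rewrite h pge0.
  move: psum; rewrite big1 => [/esym/eqP|s _]; first by rewrite oner_eq0.
  by apply: z0; rewrite -ltnS.
elim=> [//|s IH] sN; have [h _] := pab s.+1 sN.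
by apply: lt_le_trans h; rewrite /= mulr_gt0// IH// ltnW.
Qed.

Lemma pmf_decay rho s0 s : 0 <= rho ->
  (forall s, (0 < s <= N)%N -> pmf s <= rho * pmf s.-1) ->
  (s0 <= s)%N -> (s <= N)%N -> pmf s <= rho ^+ (s - s0) * pmf s0.
Proof.
move=> r0 pr; elim: s => [|s IH]; first by rewrite leqn0 => /eqP -> _; rewrite expr0 mul1r.
rewrite leq_eqVlt => /predU1P[->|]; first by rewrite subnn expr0 mul1r.
rewrite ltnS => s0s sN; apply: (le_trans (pr s.+1 sN)) => /=.
by rewrite subSn// exprS -mulrA ler_wpM2l// IH// ltnW.
Qed.

End dimension_prior.

(** * Explicit constants *)

Section constants.
Context {R : realType}.

(* Every element of the support of beta0 costs the evidence a factor
   p^-(L2 + c0 + 4), and the box for Gamma a further p^-'C(r.+1, 2); the remaining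
   powers of p absorb the number of sizes s and make the bound vanish. The factor
   2 / A4 is there because A2 p^-A4 <= p^-(A4 / 2) for p large. *)
Definition dim_const (r : nat) (c0 A4 L2 : R) : R :=
  1 + 2 / A4 * (L2 + c0 + 'C(r.+1, 2)%:R + 7).

(** The summands bound the three terms of the exponent in [lik_ratio_ge] for [tau = 3 r / p],
    [t = n^2] and [th = n^-2]: normalising constants, true quadratic form, shift of the mean. *)
Definition lik_const (q r : nat) (sigma2 Mobs zeta : R) : R :=
  3 * Mobs * zeta ^+ 2 * r%:R / sigma2 + 1 + 2 * Mobs * q%:R ^+ 4 / sigma2.

(** [2 * q%:R] comes from the [q p + 1 <= 2 q p] possible sizes; the rest inverts the part of the
    evidence bound that is free of [p] and of the truth. *)
Definition bound_const (q r : nat) (sigma2 Mobs lo hi zeta d : R) (Sigma : 'M[R]_r) : R :=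
  2 * q%:R * (iwishart_mass d Sigma / kernel_lb d Sigma lo (hi + 3 * r%:R)) *
  expR (lik_const q r sigma2 Mobs zeta).

End constants.

(** * The bound for a given number of subjects *)

Section fixed_n.
Context {R : realType} {q p r n : nat}.
Variables (f : 'cV[R]_q -> R -> R) (sigma2 K K' Mobs c0 lo hi A2 A4 L1 L2 L3 zeta : R).
Variables (D : design R p r n) (pmf : nat -> R) (lambda d : R) (Sigma : 'M[R]_r).
Hypotheses (q_gt0 : (0 < q)%N) (r_gt0 : (0 < r)%N) (n_gt0 : (0 < n)%N) (np : (n < p)%N).
Hypotheses (sigma2_gt0 : 0 < sigma2) (K_gt0 : 0 < K).
Hypothesis f_lip : forall x y t, `|f x t - f y t| <= K * norm2 (x - y).
Hypotheses (Mobs1 : 1 <= Mobs) (nobsM : forall i, (nobs D i)%:R <= Mobs).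
Hypothesis pmf_gt0 : forall s, (s <= q * p)%N -> 0 < pmf s.
Hypotheses (lambda_gt0 : 0 < lambda) (d_gt : r%:R - 1 < d).
Hypotheses (c0_gt0 : 0 < c0) (lo_gt0 : 0 < lo) (lohi : lo <= hi).
Hypotheses (A2_gt0 : 0 < A2) (A4_gt0 : 0 < A4).
Hypothesis pmf_dec : forall s, (0 < s <= q * p)%N ->
  pmf s <= A2 * p%:R `^ (- A4) * pmf s.-1.
Hypotheses (L1_gt0 : 0 < L1) (L2_gt0 : 0 < L2) (L3_gt0 : 0 < L3).
Hypothesis K'E : K' = Num.sqrt (K ^+ 2 * Mobs).
Hypothesis lambda_ge : norm_col (Xmx (q := q) D) * K' / (L1 * p%:R `^ L2) <= lambda.
Hypothesis lambda_le : lambda <= L3 * norm_col (Xmx (q := q) D) * K' / Num.sqrt n%:R.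
Hypotheses (zeta_gt0 : 0 < zeta) (Zzeta : forall i, norm_sp (random_design D i) <= zeta).
Hypothesis mass_gt0 : 0 < iwishart_mass d Sigma.

Let P : R := p%:R.
Let l := ln P.
Let cr := 'C(r.+1, 2).
(** The part of the cost per support coordinate in [delta_ge] that does not grow with [p]. *)
Let a := ln q%:R + ln L1 + L3.
Hypothesis a_le : a <= l.
Hypothesis A2_le : ln A2 <= A4 / 2 * l.

Variables (beta0 : 'cV[R]_(q * p)) (G0 : 'M[R]_r).
Hypothesis beta0_neq0 : beta0 != 0.
Hypothesis beta0_le : norm_inf beta0 <= c0 * lambda^-1 * ln p%:R.
Hypothesis G0_posdef : posdefmx G0.
Hypotheses (G0_lo : lo <= rho_min G0) (G0_hi : rho_max G0 <= hi).

Let X := norm_col (Xmx (q := q) D).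
Let s0 := #|supp beta0|.
Let N := (\sum_(i < n) nobs D i)%N.
(* radius of the box around beta0, for which [lambda * eta] is polynomial in p *)
Let eta := P ^- 3 / (X * K').
Let dc := dim_const r c0 A4 L2.
Let lc := lik_const q r sigma2 Mobs zeta.
Let bc := bound_const q sigma2 Mobs lo hi zeta d Sigma.
Let klb := kernel_lb d Sigma lo (hi + 3 * r%:R).

Let n1 : 1 <= n%:R :> R. Proof. by rewrite ler1n. Qed.
Let P1 : 1 < P. Proof. by rewrite /P ltr1n (leq_ltn_trans n_gt0). Qed.
Let P_gt0 : 0 < P. Proof. exact: lt_trans P1. Qed.
Let nP : n%:R <= P. Proof. by rewrite /P ler_nat ltnW. Qed.
Let l_gt0 : 0 < l. Proof. by rewrite ln_gt0. Qed.
Let expl : P = expR l. Proof. by rewrite /l lnK. Qed.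
Let powP x : P `^ x = expR (x * l). Proof. by rewrite /powR gt_eqF. Qed.
Let q1 : 1 <= q%:R :> R. Proof. by rewrite ler1n. Qed.

Let K'_gt0 : 0 < K'.
Proof. by rewrite K'E sqrtr_gt0 mulr_gt0 ?exprn_gt0// (lt_le_trans ltr01). Qed.

Let KK' : K <= K'.
Proof.
rewrite K'E -[leLHS]ger0_norm ?(ltW K_gt0)// -sqrtr_sqr ler_wsqrtr//.
by rewrite ler_peMr// sqr_ge0.
Qed.

(** A zero design would force [lambda <= 0] through the upper bound on [lambda]. *)
Let X_gt0 : 0 < X.
Proof.
have X0 : 0 <= X by exact: bigmax_ge_id.
rewrite lt_neqAle X0 andbT; apply/eqP => XE.
by move: lambda_le; rewrite -/X -XE mulr0 !mul0r leNgt lambda_gt0.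
Qed.

Let XK_gt0 : 0 < X * K'. Proof. exact: mulr_gt0. Qed.

Let eta_gt0 : 0 < eta.
Proof. by rewrite divr_gt0// invr_gt0 exprn_gt0. Qed.

Let s0_gt0 : (0 < s0)%N.
Proof.
rewrite lt0n; apply/eqP => /eqP; rewrite cards_eq0 => /eqP S0.
move/negP: beta0_neq0; apply; apply/eqP/colP => k; rewrite mxE; apply/eqP.
apply/negPn/negP => bk; have : k \in supp beta0 by rewrite inE.
by rewrite S0 finset.in_set0.
Qed.

Let s0_le : (s0 <= q * p)%N.
Proof. by rewrite -[leqRHS]card_ord max_card. Qed.

Let N_le : N%:R <= Mobs * n%:R.
Proof.
rewrite natr_sum; apply: (@le_trans _ _ (\sum_(i < n) Mobs)); first exact: ler_sum.
by rewrite sumr_const card_ord mulr_natr.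
Qed.

Let lambda_eta_ge : expR (- (ln L1 + (L2 + 3) * l)) <= lambda * eta.
Proof.
rewrite opprD expRD expRN lnK ?posrE// mulrDl opprD expRD.
have -> : expR (- (3 * l)) = P ^- 3 by rewrite expRN expRM_natl -expl.
rewrite expRN -powP mulrA /eta mulrCA [leRHS]mulrC ler_pM2r ?invr_gt0 ?exprn_gt0//.
by rewrite ler_pdivlMr// mulrC -invfM.
Qed.

(** Across the box of radius [eta] the Laplace density then loses at most a factor [expR (- L3)] per
    coordinate. *)
Let lambda_eta_le : lambda * eta <= L3.
Proof.
have P3 : P ^- 3 <= 1 by rewrite invf_le1 ?exprn_gt0// exprn_ege1// ltW.
have h1 : lambda <= L3 * (X * K').
  apply: (le_trans lambda_le); rewrite -/X -(mulrA L3) ler_piMr//.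
    by rewrite !mulr_ge0// ltW.
  have sn : 1 <= Num.sqrt n%:R :> R by rewrite -[leLHS]sqrtr1 ler_wsqrtr.
  by rewrite invf_le1//; exact: lt_le_trans sn.
rewrite /eta mulrA ler_pdivrMr//; apply: (le_trans _ h1).
by rewrite ler_piMr// ltW.
Qed.

Let Ztr_le : forall i w, sqn ((random_design D i)^T *m w) <= zeta ^+ 2 * sqn w.
Proof.
move=> i; apply: sqn_trmx_le => // v.
apply: (le_trans (norm_sp_sqn _ _ r_gt0)); apply: ler_wpM2r; first exact: sqn_ge0.
by rewrite ler_sqr ?nnegrE ?sqrtr_ge0// ltW.
Qed.

Let lik_ge (beta : 'cV[R]_(q * p)) (G : 'M[R]_r) (y : sample D) : posdefmx G ->
  (forall v, qf G0 v <= qf G v <= qf G0 v + 3 * r%:R * P^-1 * sqn v) ->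
  (forall k, `|beta k 0 - beta0 k 0| <= eta) ->
  (forall k, k \notin supp beta0 -> beta k 0 = 0) ->
  qf (precision sigma2 D G0) (col_of_tuple y - mean_vec f D beta0) <= n%:R ^+ 2 ->
  expR (- lc) <= lik_ratio f sigma2 beta0 G0 beta G y.
Proof.
move=> pG GG0 be bS Qy.
pose e := K * (q%:R * (X * (s0%:R * eta))).
have h := lik_ratio_ge sigma2_gt0 G0_posdef pG _ _ Ztr_le GG0
  (fun i j => reg_mean_dist K_gt0 f_lip j be bS) Qy.
(* The weight in Young's inequality is [n^-2], matched to the threshold [n^2] so that their product
   is 1. *)
have n20 : 0 < n%:R ^- 2 :> R by rewrite invr_gt0 exprn_gt0 ?(lt_le_trans ltr01).
have t0 : 0 <= 3 * r%:R / P by rewrite divr_ge0 ?mulr_ge0 ?(ltW P_gt0).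
apply: (le_trans _ (h _ t0 n20)).
rewrite ler_expR lerN2 /lc /lik_const -/N -/X -/s0 -/e invrK mulVf; last first.
  by rewrite expf_neq0// gt_eqF// (lt_le_trans ltr01).
have nP' : n%:R / P <= 1 by rewrite ler_pdivrMr// mul1r.
have M0 : 0 <= Mobs := le_trans ler01 Mobs1.
have e0 : 0 <= e.
  apply: mulr_ge0; [exact: ltW|apply: mulr_ge0 => //].
  by apply: mulr_ge0; [exact: ltW|apply: mulr_ge0 => //; exact: ltW].
(* The factor [X * K'] in the denominator of [eta] cancels the design and, as [K <= K'], the
   Lipschitz constant; [s0 <= q p] then uses up one of the three powers of [p]. *)
have e_le : e <= q%:R ^+ 2 * P ^- 2.
  have -> : e = (K / K') * (q%:R * (s0%:R * P ^- 3)).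
    by rewrite /e /eta; field; rewrite !gt_eqF.
  apply: (@le_trans _ _ (1 * (q%:R * ((q%:R * P) * P ^- 3)))).
    apply: ler_pM; rewrite ?mulr_ge0 ?invr_ge0 ?exprn_ge0 ?(ltW K_gt0) ?(ltW K'_gt0) ?(ltW P_gt0)//.
      by rewrite ler_pdivrMr// mul1r.
    rewrite ler_pM2l ?(lt_le_trans ltr01)// ler_pM2r ?invr_gt0 ?exprn_gt0//.
    by rewrite /P -natrM ler_nat.
  by rewrite le_eqVlt; apply/orP; left; apply/eqP; field; rewrite gt_eqF.
apply: lerD; first apply: lerD => //.
- apply: (@le_trans _ _ (Mobs * n%:R * (zeta ^+ 2 * (3 * r%:R * P^-1) / sigma2))).
    apply: ler_wpM2r => //; rewrite divr_ge0 ?(ltW sigma2_gt0)//.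
    by rewrite mulr_ge0 ?sqr_ge0// !mulr_ge0// invr_ge0 ltW.
  have -> : Mobs * n%:R * (zeta ^+ 2 * (3 * r%:R * P^-1) / sigma2) =
      3 * Mobs * zeta ^+ 2 * r%:R / sigma2 * (n%:R / P).
    by field; rewrite !gt_eqF.
  rewrite ler_piMr// divr_ge0 ?(ltW sigma2_gt0)//.
  by rewrite !mulr_ge0// ltW.
(* [1 + n^2 <= 2 n^2], and the product is a constant times [n^3 p^-4], at most that constant. *)
- apply: (@le_trans _ _ ((2 * n%:R ^+ 2) * (Mobs * n%:R * (q%:R ^+ 2 * P ^- 2) ^+ 2 / sigma2))).
    apply: ler_pM.
    + by rewrite addr_ge0// exprn_ge0.
    + by rewrite divr_ge0 ?(ltW sigma2_gt0)// mulr_ge0// sqr_ge0.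
    + have : 1 <= n%:R ^+ 2 :> R by rewrite exprn_ege1.
      lra.
    + rewrite ler_pM2r ?invr_gt0//; apply: ler_pM => //; first exact: sqr_ge0.
      by rewrite ler_sqr ?nnegrE// (le_trans e0).
  have -> : 2 * n%:R ^+ 2 * (Mobs * n%:R * (q%:R ^+ 2 * P ^- 2) ^+ 2 / sigma2) =
      2 * Mobs * q%:R ^+ 4 / sigma2 * ((n%:R / P) ^+ 3 / P).
    by field; rewrite !gt_eqF.
  rewrite ler_piMr//.
    by rewrite divr_ge0 ?(ltW sigma2_gt0)// !mulr_ge0.
  rewrite ler_pdivrMr// mul1r (le_trans _ (ltW P1))// exprn_ile1//.
  by rewrite divr_ge0// ltW.
Qed.

Let B := c0 * lambda^-1 * ln p%:R.
Let delta := pmf s0 / 'C(q * p, s0)%:R *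
  ((lambda * eta * expR (- (lambda * (B + eta)))) ^+ s0 *
   (klb / iwishart_mass d Sigma * expR (- lc) * (2 * P^-1) ^+ cr)).

Let klb_gt0 : 0 < klb.
Proof.
by apply: kernel_lb_gt0; rewrite ltr_wpDr ?mulr_ge0// (lt_le_trans lo_gt0).
Qed.

Let delta_gt0 : 0 < delta.
Proof.
apply: mulr_gt0; first by apply: divr_gt0; [exact: pmf_gt0|rewrite ltr0n bin_gt0].
apply: mulr_gt0; first by apply: exprn_gt0; apply: mulr_gt0;
  [exact: mulr_gt0|exact: expR_gt0].
apply: mulr_gt0; last by rewrite exprn_gt0// mulr_gt0 ?invr_gt0.
by apply: mulr_gt0; [exact: divr_gt0|exact: expR_gt0].
Qed.

Let evidence_ge (y : sample D) :
  qf (precision sigma2 D G0) (col_of_tuple y - mean_vec f D beta0) <= n%:R ^+ 2 ->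
  (delta%:E <= prior_int pmf lambda d Sigma
     (fun z => (lik_ratio f sigma2 beta0 G0 z.1 z.2 y)%:E))%E.
Proof.
move=> Qy; apply: (@prior_beta_ge R (q * p) pmf lambda eta B _ beta0) => //.
- by move=> s sN; exact/ltW/pmf_gt0.
- by move=> k; apply: le_trans beta0_le; exact: (le_bigmax _ (fun j => `|beta0 j 0|)).
- apply: mulr_ge0; last by rewrite exprn_ge0// mulr_ge0// invr_ge0 ltW.
  by apply: mulr_ge0; [apply: ltW; exact: divr_gt0|exact: expR_ge0].
- move=> b; rewrite /prior_Gamma_int; apply: integral_ge0 => g pg.
  rewrite -EFinM lee_fin mulr_ge0//.
    by rewrite divr_ge0 ?(ltW mass_gt0)// mulr_ge0 ?powR_ge0 ?expR_ge0.
  by rewrite lik_ratioE divr_ge0// ltW// pdf_gt0.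
- move=> b be bS; apply: (@prior_Gamma_ge R r d Sigma G0 lo hi P^-1) => //.
  + by move: d_gt => dr; have : 0 <= r%:R :> R by []; lra.
  + exact: lt_le_trans lohi.
  + move=> v; have h1 := rho_min_le v r_gt0 G0_posdef.1.
    have h2 := rho_max_ge v r_gt0 G0_posdef.1.
    apply/andP; split; [apply: le_trans h1|apply: (le_trans h2)];
      by apply: ler_wpM2r => //; exact: sqn_ge0.
  + by rewrite invr_gt0.
  + by rewrite invf_le1// ltW.
  + by move=> G pG; rewrite lik_ratioE divr_ge0// ltW// pdf_gt0.
  + by move=> G pG GG0; exact: lik_ge.
Qed.

(** Each size beyond [s0] costs a factor [p^(- A4 / 2)], and [s > dc * s0] leaves enough such
    factors for the stated power. Every term gets this same bound, multiplied by the number of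
    sizes. *)
Let sum_big_le :
  \sum_(S : {set 'I_(q * p)} | dc * s0%:R < #|S|%:R) pmf #|S| / 'C(q * p, #|S|)%:R
  <= 2 * q%:R * P * (expR (- ((L2 + c0 + cr%:R + 7) * (s0%:R * l))) * pmf s0).
Proof.
rewrite (sum_set_card _ (fun s : nat => dc * s0%:R < s%:R) pmf).
have Eg0 : 0 <= L2 + c0 + cr%:R + 7 by rewrite !addr_ge0// ltW.
apply: (@le_trans _ _ (\sum_(s < (q * p).+1)
    expR (- ((L2 + c0 + cr%:R + 7) * (s0%:R * l))) * pmf s0)); last first.
  rewrite sumr_const card_ord -[leLHS]mulr_natl; apply: ler_wpM2r.
    by rewrite mulr_ge0 ?expR_ge0// ltW// pmf_gt0.
  rewrite -natr1 natrM -/P.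
  have : 1 <= q%:R * P by rewrite mulr_ege1// ltW.
  lra.
rewrite big_mkcond; apply: ler_sum => s _; case: ifPn => [cs|_]; last first.
  by rewrite mulr_ge0 ?expR_ge0// ltW// pmf_gt0.
have s0R : 0 <= s0%:R :> R by [].
have s0s : (s0 <= s)%N.
  rewrite -(ler_nat R) (le_trans _ (ltW cs))// ler_peMl// /dc /dim_const lerDl.
  by rewrite mulr_ge0// divr_ge0// ltW.
have rho_le : A2 * P `^ (- A4) <= expR (- (A4 / 2 * l)).
  rewrite powP -[A2]lnK ?posrE// -expRD ler_expR.
  have -> : - A4 * l = - (A4 / 2 * l) - A4 / 2 * l by field.
  by move: A2_le; move: (A4 / 2 * l) (ln A2) => x y; lra.
apply: (@le_trans _ _ (expR (- (A4 / 2 * l)) ^+ (s - s0) * pmf s0)).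
  apply: (@pmf_decay R (q * p)) => //; last by rewrite -ltnS.
  move=> s' s'N; apply: (le_trans (pmf_dec s'N)); apply: ler_wpM2r => //.
  apply/ltW/pmf_gt0; move: s'N => /andP[_]; exact: leq_trans (leq_pred _).
apply: ler_wpM2r; first by rewrite ltW// pmf_gt0.
rewrite -expRM_natl ler_expR mulrN lerN2 natrB//.
have h : 2 / A4 * (L2 + c0 + cr%:R + 7) * s0%:R <= s%:R - s0%:R.
  by move: (ltW cs); rewrite /dc /dim_const mulrDl mul1r -lerBrDl.
have -> : (L2 + c0 + cr%:R + 7) * (s0%:R * l) =
    2 / A4 * (L2 + c0 + cr%:R + 7) * s0%:R * (A4 / 2 * l).
  by field; rewrite gt_eqF.
by rewrite ler_wpM2r// mulr_ge0// ?divr_ge0// ltW.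
Qed.

(** The logarithmic cost of each support coordinate has three sources: [ln q + l] from 'C(q p, s0)
    <= (q p)^s0, [ln L1 + (L2 + 3) * l] from [lambda * eta], and [c0 * l + L3] from the Laplace
    exponent. *)
Let delta_ge : expR (- (s0%:R * (a + (L2 + c0 + 4) * l) + cr%:R * l)) *
  (pmf s0 * (klb / iwishart_mass d Sigma * expR (- lc))) <= delta.
Proof.
have m0 : 0 <= klb / iwishart_mass d Sigma * expR (- lc).
  by apply: mulr_ge0; [apply: ltW; exact: divr_gt0|exact: expR_ge0].
rewrite opprD expRD /delta.
have C_gt0 : 0 < 'C(q * p, s0)%:R :> R by rewrite ltr0n bin_gt0.
have C_ge : expR (- (s0%:R * (ln q%:R + l))) <= 'C(q * p, s0)%:R^-1.
  rewrite expRN lef_pV2 ?posrE ?expR_gt0// expRM_natl expRD lnK ?posrE ?(lt_le_trans ltr01)//.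
  rewrite -expl /P -natrM -natrX ler_nat; exact: bin_le_expn.
have lam_ge : expR (- (ln L1 + (L2 + 3) * l + c0 * l + L3)) <=
    lambda * eta * expR (- (lambda * (B + eta))).
  have -> : lambda * (B + eta) = c0 * l + lambda * eta.
    by rewrite /B mulrDr -/l; congr (_ + _); field; rewrite gt_eqF.
  rewrite -[X in expR (- X)]addrA opprD expRD; apply: ler_pM; rewrite ?expR_ge0//.
  by rewrite ler_expR lerN2 lerD2l.
have P_ge : expR (- (cr%:R * l)) <= (2 * P^-1) ^+ cr.
  rewrite -mulrN expRM_natl expRN -expl lerXn2r ?nnegrE ?mulr_ge0 ?invr_ge0 ?(ltW P_gt0)//.
  by rewrite ler_peMl// ?ler1n// invr_ge0 ltW.
have -> : s0%:R * (a + (L2 + c0 + 4) * l) =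
    s0%:R * (ln q%:R + l) + s0%:R * (ln L1 + (L2 + 3) * l + c0 * l + L3).
  by rewrite /a; ring.
rewrite opprD expRD.
have -> : expR (- (s0%:R * (ln L1 + (L2 + 3) * l + c0 * l + L3))) =
    expR (- (ln L1 + (L2 + 3) * l + c0 * l + L3)) ^+ s0.
  by rewrite -expRM_natl mulrN.
set e1 := expR (- (s0%:R * _)) in C_ge *; set e2 := expR (- (_ + L3)) in lam_ge *.
set e3 := expR (- (cr%:R * l)) in P_ge *.
set m := klb / _ * _ in m0 *.
have -> : e1 * e2 ^+ s0 * e3 * (pmf s0 * m) = pmf s0 * (e1 * (e2 ^+ s0 * (m * e3))).
  have mulrACA5 (x1 x2 x3 x4 x5 : R) :
      x1 * x2 * x3 * (x4 * x5) = x4 * (x1 * (x2 * (x5 * x3))) by ring.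
  exact: mulrACA5.
rewrite -mulrA ler_pM2l ?pmf_gt0//.
have e20 : 0 <= e2 ^+ s0 by rewrite exprn_ge0 ?expR_ge0.
have me3 : 0 <= m * e3 by apply: mulr_ge0 => //; exact: expR_ge0.
apply: ler_pM => //; [exact: expR_ge0|exact: mulr_ge0|].
apply: ler_pM => //; last exact: ler_wpM2l.
by rewrite lerXn2r ?nnegrE ?expR_ge0// (le_trans _ lam_ge) ?expR_ge0.
Qed.

Lemma expectation_posterior_bound :
  (expectation f sigma2 beta0 G0 (fun y : sample D =>
     posterior f sigma2 pmf lambda d Sigma beta0 G0 y
       [set bG | (dim_const r c0 A4 L2 * s0%:R < #|supp bG.1|%:R)%R])
   <= (expR (Mobs * n%:R - n%:R ^+ 2 / 4) + bound_const q sigma2 Mobs lo hi zeta d Sigma / P)%:E)%E.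
Proof.
have pge0 s : (s <= q * p)%N -> 0 <= pmf s by move=> /pmf_gt0/ltW.
apply: (le_trans (expectation_posterior_le dc sigma2_gt0 K_gt0 f_lip
  pge0 lambda_gt0 G0_posdef mass_gt0 delta_gt0 evidence_ge)).
rewrite lee_fin; apply: lerD.
  rewrite expRD; apply: ler_pM; rewrite ?exprn_ge0 ?expR_ge0//.
  (* The crude [Num.sqrt 2 <= 2 <= expR 1] suffices, since the tail is exponential in [n^2]. *)
  apply: (@le_trans _ _ (expR 1 ^+ N)).
    rewrite lerXn2r ?nnegrE ?expR_ge0//.
    apply: (@le_trans _ _ 2); last by have := @expR_ge1Dx R 1; lra.
    rewrite -[leRHS]ger0_norm// -sqrtr_sqr ler_wsqrtr// expr2; lra.
  by rewrite -expRM_natl mulr1 ler_expR.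
rewrite ler_pdivrMl//; apply: (le_trans sum_big_le).
have := ler_wpM2r (ltW (divr_gt0 (mulr_gt0 (mulr_gt0 (@ltr0Sn R 1) (lt_le_trans ltr01 q1))
   (mulr_gt0 (divr_gt0 mass_gt0 klb_gt0) (expR_gt0 lc))) P_gt0)) delta_ge.
have -> : 2 * q%:R * (iwishart_mass d Sigma / klb * expR lc) / P = bc / P.
  by rewrite /bc /bound_const -/klb -/lc; ring.
apply: le_trans.
set u := expR (- (_ + _)).
have -> : u * (pmf s0 * (klb / iwishart_mass d Sigma * expR (- lc))) * (bc / P) =
    2 * q%:R * (u / P) * pmf s0.
  rewrite /bc /bound_const -/klb -/lc expRN; field.
  by rewrite !gt_eqF// expR_gt0.
rewrite [leLHS](_ : _ = 2 * q%:R *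
    (P * expR (- ((L2 + c0 + cr%:R + 7) * (s0%:R * l)))) * pmf s0); last by ring.
rewrite ler_pM2r ?pmf_gt0// ler_pM2l ?mulr_gt0 ?(lt_le_trans ltr01 q1)//.
rewrite /u expl -expRN -!expRD ler_expR.
have s1 : 1 <= s0%:R :> R by rewrite ler1n.
have h1 : cr%:R * l <= s0%:R * (cr%:R * l) by rewrite ler_peMl// mulr_ge0// ltW.
have h2 : l <= s0%:R * l by rewrite ler_peMl// ltW.
have h3 : s0%:R * a <= s0%:R * l by rewrite ler_wpM2l.
(* Of the 7 units, 4 belong to the evidence. Of the 3 left, one pays for [a], one for the factor [P]
   from counting sizes, and one leaves the final [1 / P]. *)
have -> : (L2 + c0 + cr%:R + 7) * (s0%:R * l) =
  s0%:R * ((L2 + c0 + 4) * l) + s0%:R * (cr%:R * l) + 3 * (s0%:R * l) by ring.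
rewrite mulrDr; lra.
Qed.

End fixed_n.

(* [iwishart_mass] is [fine] of an integral, so it is also 0 when that integral is
   infinite; dividing by it then makes the whole prior vanish. Hence the
   integrability of the inverse-Wishart kernel is not needed. *)
Lemma posterior_mass0 (R : realType) (q p r n : nat) (f : 'cV[R]_q -> R -> R)
    (sigma2 : R) (D : design R p r n) (pmf : nat -> R) (lambda d : R)
    (Sigma : 'M[R]_r) beta0 G0 (y : sample D) B :
  iwishart_mass d Sigma = 0 ->
  posterior f sigma2 pmf lambda d Sigma beta0 G0 y B = 0%E.
Proof.
move=> m0; rewrite /posterior /prior_int /prior_beta_int big1 ?mul0e// => S _.
rewrite integral0_eq ?mule0// => x _; rewrite /prior_Gamma_int integral0_eq ?mule0// => g _.
by rewrite m0 invr0 mulr0 mul0e.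
Qed.

(** * Passage to the limit *)

Lemma esup0_le (R : realType) (A : set (\bar R)) (x : \bar R) : (0 <= x)%E ->
  (forall z, A z -> (z <= x)%E) -> (0 <= esup0 A <= x)%E.
Proof.
move=> x0 Ax; rewrite ereal_sup_ubound; last by left.
by apply: ge_ereal_sup => z [->|/Ax].
Qed.

Lemma tail_le_harmonic (R : realType) (M : R) (n : nat) : (0 < n)%N ->
  4 * (M + 1) <= n%:R -> expR (M * n%:R - n%:R ^+ 2 / 4) <= n%:R^-1.
Proof.
move=> n0 Mn; have n0R : 0 < n%:R :> R by rewrite ltr0n.
apply: (@le_trans _ _ (expR (- n%:R))).
  rewrite ler_expR.
  have : 0 <= n%:R * (n%:R - 4 * (M + 1)) by rewrite mulr_ge0 ?subr_ge0// ltW.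
  rewrite expr2; lra.
rewrite expRN lef_pV2 ?posrE ?expR_gt0//.
by apply: le_trans (expR_ge1Dx _); rewrite lerDr.
Qed.

Theorem theorem1
  (R : realType) (q r : nat) (hq : (0 < q)%N) (hr : (0 < r)%N)
  (sigma2 : R) (hsigma2 : 0 < sigma2)
  (f : 'cV[R]_q -> R -> R)
  (p : nat -> nat) (hp : forall n, (0 < n)%N -> (n < p n)%N)
  (D : forall n, design R (p n) r n)
  (Mobs : R)
  (hm : forall n (i : 'I_n), (0 < nobs (D n) i)%N /\ (nobs (D n) i)%:R <= Mobs)
  (* prior *)
  (pi_ : nat -> nat -> R)
  (hpi : forall n, (0 < n)%N ->
    (forall s, (s <= q * p n)%N -> 0 <= pi_ (p n) s) /\
    \sum_(s < (q * p n).+1) pi_ (p n) s = 1)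
  (lambda : nat -> R) (hlambda : forall n, (0 < n)%N -> 0 < lambda n)
  (d : R) (hd : r%:R - 1 < d)
  (Sigma : 'M[R]_r) (hSigma : posdefmx Sigma)
  (* (1) *)
  (K : R) (hK : 0 < K)
  (hf : forall x y t, `|f x t - f y t| <= K * norm2 (x - y))
  (* (2) *)
  (c0 : R) (hc0 : 0 < c0)
  (kappa : nat -> R) (hkappa : kappa n @[n --> \oo] --> 0)
  (* (3) *)
  (rhoGlo rhoGhi : R) (hrhoGlo : 0 < rhoGlo) (hrhoG : rhoGlo <= rhoGhi)
  (* (4) *)
  (A1 A2 A3 A4 : R) (hA1 : 0 < A1) (hA2 : 0 < A2) (hA3 : 0 < A3) (hA4 : 0 < A4)
  (hdim : forall n, (0 < n)%N -> forall s, (0 < s <= q * p n)%N ->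
    A1 * (p n)%:R `^ (- A3) * pi_ (p n) s.-1 <= pi_ (p n) s /\
    pi_ (p n) s <= A2 * (p n)%:R `^ (- A4) * pi_ (p n) s.-1)
  (* (5) *)
  (L1 L2 L3 : R) (hL1 : 0 < L1) (hL2 : 0 < L2) (hL3 : 0 < L3)
  (K' : R) (hK' : K' = Num.sqrt (K ^+ 2 * Mobs))
  (hlap : forall n, (0 < n)%N ->
    norm_col (Xmx (q := q) (D n)) * K' / (L1 * (p n)%:R `^ L2) <= lambda n /\
    lambda n <= L3 * norm_col (Xmx (q := q) (D n)) * K' / Num.sqrt n%:R)
  (* (6) *)
  (hrank : asymp_eq (fun n => (\sum_(i < n) (r <= nobs (D n) i)%N)%:R : R)
                    (fun n => n%:R))
  (* (7) *)
  (rhoZlo : R) (hrhoZlo : 0 < rhoZlo)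
  (hZlo : forall n (i : 'I_n), (r <= nobs (D n) i)%N ->
    rhoZlo <=
    Num.sqrt (rho_min ((random_design (D n) i)^T *m random_design (D n) i)))
  (* (8) *)
  (rhoZhi : R) (hrhoZhi : 0 < rhoZhi)
  (hZhi : forall n (i : 'I_n), norm_sp (random_design (D n) i) <= rhoZhi) :
  exists C1 : R, 0 < C1 /\
    esup0 [set expectation f sigma2 bG0.1 bG0.2 (fun y : sample (D n) =>
             posterior f sigma2 (pi_ (p n)) (lambda n) d Sigma bG0.1 bG0.2 y
               [set bG | C1 * #|supp bG0.1|%:R < #|supp bG.1|%:R])
          | bG0 in @true_betas R q (p n) n c0 (lambda n) (kappa n) `*`
                   @true_Gammas R r rhoGlo rhoGhi]
      @[n --> \oo] --> 0%E.
Proof.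
have Mobs1 : 1 <= Mobs.
  (* The single subject of the experiment with [n = 1] already has at least one observation. *)
  have [h1 h2] := hm 1%N ord0; apply: le_trans h2.
  by rewrite ler1n.
exists (dim_const r c0 A4 L2).
set C1 := dim_const _ _ _ _.
have C1_gt0 : 0 < C1.
  by rewrite /C1 /dim_const ltr_pwDl// mulr_ge0 ?divr_ge0 ?addr_ge0// ltW.
split=> //.
pose c := bound_const q sigma2 Mobs rhoGlo rhoGhi rhoZhi d Sigma.
have mass_ge0 : 0 <= iwishart_mass d Sigma.
  apply: fine_ge0; apply: integral_ge0 => g _.
  by rewrite lee_fin mulr_ge0 ?powR_ge0 ?expR_ge0.
have c_ge0 : 0 <= c.
  apply: mulr_ge0; last exact: expR_ge0.
  apply: mulr_ge0 => //; apply: divr_ge0 => //; apply/ltW/kernel_lb_gt0.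
  by rewrite ltr_wpDr ?mulr_ge0// (lt_le_trans hrhoGlo).
apply: (@squeeze_cvge _ _ _ _ (fun=> 0%E) _ (fun n => ((2 * (1 + c)) * harmonic n)%:E));
  [|exact: cvg_cst|]; last first.
  apply: cvg_EFin; first exact: nearW.
  rewrite -[X in _ --> X](mulr0 (2 * (1 + c))).
  by apply: cvgM; [exact: cvg_cst|exact: cvg_harmonic].
near=> n.
have n_gt0 : (0 < n)%N by near: n; exact: nbhs_infty_gt.
have n4 : 4 * (Mobs + 1) <= n%:R by near: n; exact: nbhs_infty_ger.
(* These thresholds involve fixed constants only, hence are uniform over the truth; since [n < p n],
   they bound [ln q + ln L1 + L3] by [ln p], and [ln A2] by [A4 / 2 * ln p]. *)
have n_ge : expR (ln q%:R + ln L1 + L3) <= n%:R by near: n; exact: nbhs_infty_ger.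
have n_ge' : expR (2 / A4 * ln A2) <= n%:R by near: n; exact: nbhs_infty_ger.
have np := hp n n_gt0.
have n0R : 0 < n%:R :> R by rewrite ltr0n.
have p0R : 0 < (p n)%:R :> R by rewrite ltr0n (ltn_trans n_gt0).
have le_lnp (x : R) : expR x <= n%:R -> x <= ln (p n)%:R.
  move=> xn; rewrite -(ler_expR x) lnK ?posrE//.
  by apply: (le_trans xn); rewrite ler_nat ltnW.
(* [harmonic n] is [1 / (n + 1)], hence the factor 2. *)
have harm : n%:R^-1 <= 2 * harmonic n :> R.
  rewrite /harmonic /= ler_pdivlMr ?ltr0Sn// mulrC ler_pdivrMr//.
  rewrite -natr1; have : 1 <= n%:R :> R by rewrite ler1n.
  lra.
have bnd0 : 0 <= 2 * (1 + c) * harmonic n.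
  apply: mulr_ge0; last exact/ltW/harmonic_gt0.
  by apply: mulr_ge0 => //; exact: addr_ge0.
apply: esup0_le; first by rewrite lee_fin.
move=> _ [[b G] [[bn0 binf bs] [pG [Glo _ Ghi]]] <-] /=.
have [mass0|mass_neq0] := eqVneq (iwishart_mass d Sigma) 0.
  rewrite /expectation integral0_eq; last first.
    by move=> y _; rewrite posterior_mass0// mule0.
  by rewrite lee_fin.
have mass_gt0 : 0 < iwishart_mass d Sigma by rewrite lt_neqAle eq_sym mass_neq0.
have [pge0 psum] := hpi n n_gt0.
have pw x : 0 < (p n)%:R `^ x :> R by exact: powR_gt0.
have pmf_gt0 := pmf_pos (mulr_gt0 hA1 (pw (- A3))) (mulr_gt0 hA2 (pw (- A4)))
  pge0 psum (hdim n n_gt0).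
have [lam1 lam2] := hlap n n_gt0.
have A2l : ln A2 <= A4 / 2 * ln (p n)%:R.
  have := le_lnp _ n_ge'; rewrite -(ler_pM2l (divr_gt0 hA4 (@ltr0Sn R 1))).
  by rewrite mulrA mulrA divfK// mulfV ?gt_eqF// mul1r.
apply: (le_trans (expectation_posterior_bound hq hr n_gt0 np hsigma2 hK hf Mobs1
  (fun i => (hm n i).2) pmf_gt0 (hlambda n n_gt0) hd hc0 hrhoGlo hrhoG hA2 hA4
  (fun s sp => (hdim n n_gt0 s sp).2) hL1 hL2 hL3 hK' lam1 lam2 hrhoZhi (hZhi n) mass_gt0
  (le_lnp _ n_ge) A2l bn0 binf pG Glo Ghi)).
rewrite lee_fin -/c; apply: (@le_trans _ _ (n%:R^-1 + c * n%:R^-1)).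
  apply: lerD; first exact: tail_le_harmonic.
  by apply: ler_wpM2l => //; rewrite lef_pV2 ?posrE// ler_nat ltnW.
rewrite -[X in X + _]mul1r -mulrDl mulrAC [leRHS]mulrC.
by apply: ler_wpM2l => //; rewrite addr_ge0.
Unshelve. all: by end_near.
Qed.
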